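(* Let $k$ be a commutative ring, $\mathcal{A}$ a small $k$-linear additive category and $\mathcal{X}\subseteq\mathcal{A}$ a full additive subcategory. View $\mathcal{A}$ and $\mathcal{X}$ as dg categories concentrated in degree zero, and let $\mathcal{A}/\mathcal{X}$ be the dg quotient category. Then for any objects $A, B$ of $\mathcal{A}/\mathcal{X}$, the Hom complex $(\mathcal{A}/\mathcal{X})(A, B)$ is non-positively graded, and the following statements hold. (1) $H^0((\mathcal{A}/\mathcal{X})(A, B))\simeq (\mathcal{A}/[\mathcal{X}])(A, B)$. (2) $H^{-1}((\mathcal{A}/\mathcal{X})(A, B))$ is isomorphic to the kernel of the canonical map $${\rm can}\colon \mathcal{A}(-, B)\otimes_\mathcal{X} \mathcal{A}(A, -)\longrightarrow \mathcal{A}(A, B),\quad g\otimes f\mapsto g\circ f.$$ (3) For each $n\geq 2$, $H^{-n}((\mathcal{A}/\mathcal{X})(A, B))\simeq {\rm Tor}^\mathcal{X}_{n-1}(\mathcal{A}(-, B), \mathcal{A}(A, -))$.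
   Context: Factor category: $[\mathcal{X}]$ is the two-sided ideal of $\mathcal{A}$ formed by morphisms factoring through an object of $\mathcal{X}$; $\mathcal{A}/[\mathcal{X}]$ has the same objects as $\mathcal{A}$ and $(\mathcal{A}/[\mathcal{X}])(A,B)=\mathcal{A}(A,B)/[\mathcal{X}](A,B)$. Modules: a left (resp. right) $\mathcal{X}$-module is an additive covariant (resp. contravariant) functor from $\mathcal{X}$ to abelian groups. $\otimes_\mathcal{X}$ is the usual tensor bifunctor between right and left $\mathcal{X}$-modules and ${\rm Tor}^\mathcal{X}_n$ its derived functors. $\mathcal{A}(-,B)$ and $\mathcal{A}(A,-)$ are viewed, by restriction to $\mathcal{X}$, as a right and a left $\mathcal{X}$-module respectively. Explicitly, $\mathcal{A}(-,B)\otimes_\mathcal{X}\mathcal{A}(A,-)=\big(\bigoplus_{X\in\mathcal{X}}\mathcal{A}(X,B)\otimes_{\mathbb{Z}}\mathcal{A}(A,X)\big)/I$, where $I$ is generated by the elements $b\circ x\otimes a-b\otimes x\circ a$ for all $x\colon X\to X'$ in $\mathcal{X}$, $a\colon A\to X$, $b\colon X'\to B$. In the map ${\rm can}$, $g\colon X\to B$ and $f\colon A\to X$ with $X\in\mathcal{X}$. Dg quotient (Keller, Drinfeld): take a semi-free resolution $\pi\colon\tilde{\mathcal{A}}\to\mathcal{A}$ over $k$ as in Drinfeld's ''DG quotients of DG categories'', Lemma B.5, i.e. $\tilde{\mathcal{A}}$ is a semi-free dg $k$-category with the same objects as $\mathcal{A}$ and $\pi$ is the identity on objects and a quasi-isomorphism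 on Hom complexes; since $\mathcal{A}$ is concentrated in degree zero, the Hom complexes of $\tilde{\mathcal{A}}$ are non-positively (cohomologically) graded. Let $\tilde{\mathcal{X}}\subseteq\tilde{\mathcal{A}}$ be the full dg subcategory on the objects of $\mathcal{X}$. Then $\mathcal{A}/\mathcal{X}:=\tilde{\mathcal{A}}/\tilde{\mathcal{X}}$ is the dg category with the same objects as $\tilde{\mathcal{A}}$ obtained by freely adjoining, for each object $X\in\tilde{\mathcal{X}}$, a new endomorphism $\varepsilon_X$ of $X$ of degree $-1$ with $d(\varepsilon_X)={\rm Id}_X$. Thus, as a graded $k$-module, its Hom from $A$ to $B$ is the direct sum over $m\ge 0$ and over $X_1,\dots,X_m\in\mathcal{X}$ of the spaces of formal composites $f_m\varepsilon_{X_m}f_{m-1}\cdots\varepsilon_{X_1}f_0$, i.e. $\tilde{\mathcal{A}}(X_m,B)\otimes_k\cdots\otimes_k\tilde{\mathcal{A}}(A,X_1)$ shifted by $m$ (for $m=0$: $\tilde{\mathcal{A}}(A,B)$), with differential determined by the graded Leibniz rule. It is unique up to quasi-equivalence. *)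

(* Defs.v *)
From HB Require Import structures.
From mathcomp Require Import all_boot all_algebra.
From mathcomp Require Import boolp.
From mathcomp Require Import freeg.

Set Implicit Arguments.
Unset Strict Implicit.
Unset Printing Implicit Defensive.

Import GRing.Theory.
Local Open Scope ring_scope.
Local Open Scope quotient_scope.

Definition isomorphic (k : pzRingType) (U V : lmodType k) : Prop :=
  exists f : {linear U -> V}, bijective f.

Section QuotientModule.
Variables (k : pzRingType) (V : lmodType k) (S : submodClosed V).

(* A submodClosed predicate is not automatically a zmodClosed one, which is
   what Quotient.quot takes. *)
Definition quotmod_pred : {pred V} := S.
Fact quotmod_pred_zmod : zmod_closed quotmod_pred.
Proof. exact: GRing.submod_closedB (submodClosedP S). Qed.
HB.instance Definition _ :=
  GRing.isZmodClosed.Build V quotmod_pred quotmod_pred_zmod.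

Definition quotmod : Type := Quotient.quot quotmod_pred.
HB.instance Definition _ := GRing.Zmodule.on quotmod.

Definition quotmod_pi (v : V) : quotmod := \pi_(Quotient.quot quotmod_pred) v.

Lemma quotmod_piE (u v : V) : (quotmod_pi u = quotmod_pi v) <-> (u - v \in S).
Proof.
rewrite /quotmod_pi -[_ \in S]/(u - v \in quotmod_pred); split=> [e|uvS].
  by rewrite (Quotient.idealrBE quotmod_pred) e.
by apply/eqP; rewrite -(Quotient.idealrBE quotmod_pred).
Qed.

Lemma quotmod_piD : {morph quotmod_pi : u v / u + v}.
Proof. by move=> u v; rewrite /quotmod_pi raddfD. Qed.

Lemma quotmod_piK (x : quotmod) :
  quotmod_pi (repr (x : Quotient.quot quotmod_pred)) = x.
Proof. exact: reprK. Qed.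

Definition quotmod_scale (c : k) (x : quotmod) : quotmod :=
  quotmod_pi (c *: repr (x : Quotient.quot quotmod_pred)).

Lemma quotmod_scale_pi c v : quotmod_scale c (quotmod_pi v) = quotmod_pi (c *: v).
Proof.
apply/quotmod_piE; rewrite -scalerBr rpredZ//.
by apply/quotmod_piE; rewrite quotmod_piK.
Qed.

Fact quotmod_scaleA c d x :
  quotmod_scale c (quotmod_scale d x) = quotmod_scale (c * d) x.
Proof. by rewrite -[x]quotmod_piK !quotmod_scale_pi scalerA. Qed.

Fact quotmod_scale1 : left_id 1 quotmod_scale.
Proof. by move=> x; rewrite -[x]quotmod_piK quotmod_scale_pi scale1r. Qed.

Fact quotmod_scaleDr : right_distributive quotmod_scale +%R.
Proof.
move=> c x y; rewrite -[x]quotmod_piK -[y]quotmod_piK -quotmod_piD.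
by rewrite !quotmod_scale_pi scalerDr quotmod_piD.
Qed.

Fact quotmod_scaleDl x : {morph quotmod_scale^~ x : c d / c + d}.
Proof.
move=> c d; rewrite -[x]quotmod_piK !quotmod_scale_pi.
by rewrite scalerDl quotmod_piD.
Qed.

HB.instance Definition _ := GRing.Zmodule_isLmodule.Build k quotmod
  quotmod_scaleA quotmod_scale1 quotmod_scaleDr quotmod_scaleDl.

Fact quotmod_pi_linear : linear quotmod_pi.
Proof.
by move=> c u v; rewrite quotmod_piD -quotmod_scale_pi.
Qed.
HB.instance Definition _ :=
  GRing.isLinear.Build k V quotmod _ quotmod_pi quotmod_pi_linear.

End QuotientModule.

Section Kernel.
Variables (k : pzRingType) (U V : lmodType k) (f : {linear U -> V}).

Definition kerpred : {pred U} := [pred u | f u == 0].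

Fact kerpred_submod : submod_closed kerpred.
Proof.
split=> [|c u v]; rewrite !inE ?linear0//.
by move=> /eqP fu /eqP fv; rewrite linearP fu fv scaler0 addr0.
Qed.
HB.instance Definition _ :=
  GRing.isSubmodClosed.Build k U kerpred kerpred_submod.

Record kermod : Type := KerMod { ker_val : U; ker_valP : ker_val \in kerpred }.
HB.instance Definition _ := [isSub for ker_val].
HB.instance Definition _ := [Choice of kermod by <:].
HB.instance Definition _ := [SubChoice_isSubLmodule of kermod by <:].

End Kernel.

(* ker g / (im f :&: ker g); in all uses g \o f = 0, so this is ker g / im f. *)
Section Homology.
Variables (k : pzRingType) (U V W : lmodType k).
Variables (f : {linear U -> V}) (g : {linear V -> W}).

Definition boundary : {pred kermod g} :=
  fun z => `[< exists u, f u = \val z >].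

Fact boundary_submod : submod_closed boundary.
Proof.
split=> [|c z z']; first by apply/asboolP; exists 0; rewrite !linear0.
move=> /asboolP[u fu] /asboolP[u' fu']; apply/asboolP; exists (c *: u + u').
by rewrite linearP fu fu' linearP.
Qed.
HB.instance Definition _ :=
  GRing.isSubmodClosed.Build k (kermod g) boundary boundary_submod.

Definition homology : lmodType k := quotmod boundary.

End Homology.

Record klincat (k : comPzRingType) := KLinCat {
  klob :> Type;
  klhom :> klob -> klob -> lmodType k;
  klid : forall a, klhom a a;
  klcomp : forall a b c, klhom b c -> klhom a b -> klhom a c;
  klcompA : forall a b c d (h : klhom c d) (g : klhom b c) (f : klhom a b),
    klcomp h (klcomp g f) = klcomp (klcomp h g) f;
  klcomp1l : forall a b (f : klhom a b), klcomp (klid b) f = f;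
  klcomp1r : forall a b (f : klhom a b), klcomp f (klid a) = f;
  klcomp_linl : forall a b c (f : klhom a b),
    linear (fun g : klhom b c => klcomp g f);
  klcomp_linr : forall a b c (g : klhom b c), linear (@klcomp a b c g)
}.
Arguments klid {k} _ _.
Arguments klcomp {k _ a b c} g f.

Section LinearCategories.
Variables (k : comPzRingType) (A : klincat k).

Lemma klcompDl (a b c : A) (g g' : A b c) (f : A a b) :
  klcomp (g + g') f = klcomp g f + klcomp g' f.
Proof. by have := klcomp_linl f 1 g g'; rewrite !scale1r. Qed.
Lemma klcompDr (a b c : A) (g : A b c) (f f' : A a b) :
  klcomp g (f + f') = klcomp g f + klcomp g f'.
Proof. by have := klcomp_linr g 1 f f'; rewrite !scale1r. Qed.
Lemma klcomp0l (a b c : A) (f : A a b) : klcomp (0 : A b c) f = 0.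
Proof. by apply: (addrI (klcomp 0 f)); rewrite -klcompDl !addr0. Qed.
Lemma klcomp0r (a b c : A) (g : A b c) : klcomp g (0 : A a b) = 0.
Proof. by apply: (addrI (klcomp g 0)); rewrite -klcompDr !addr0. Qed.
Lemma klcompZl (a b c : A) l (g : A b c) (f : A a b) :
  klcomp (l *: g) f = l *: klcomp g f.
Proof. by have := klcomp_linl f l g 0; rewrite !addr0 klcomp0l addr0. Qed.
Lemma klcompZr (a b c : A) l (g : A b c) (f : A a b) :
  klcomp g (l *: f) = l *: klcomp g f.
Proof. by have := klcomp_linr g l f 0; rewrite !addr0 klcomp0r addr0. Qed.

Definition is_zero_object (z : A) : Prop :=
  (forall (a : A) (f : A z a), f = 0) /\ (forall (a : A) (f : A a z), f = 0).

Definition is_biproduct (a b c : A) : Prop :=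
  exists (i1 : A a c) (i2 : A b c) (p1 : A c a) (p2 : A c b),
    [/\ klcomp p1 i1 = klid A a, klcomp p2 i2 = klid A b,
        klcomp p2 i1 = 0, klcomp p1 i2 = 0 &
        klcomp i1 p1 + klcomp i2 p2 = klid A c].

Definition additive_cat : Prop :=
  (exists z, is_zero_object z) /\ (forall a b, exists c, is_biproduct a b c).

Definition fullsub (X : A -> Prop) : klincat k :=
  @KLinCat k {a : A | X a} (fun a b => A (sval a) (sval b))
    (fun a => klid A (sval a)) (fun a b c g f => klcomp g f)
    (fun a b c d h g f => klcompA h g f)
    (fun a b f => klcomp1l f) (fun a b f => klcomp1r f)
    (fun a b c f => @klcomp_linl k A _ _ (sval c) f)
    (fun a b c g => @klcomp_linr k A (sval a) _ _ g).

End LinearCategories.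

(* The Hom-modules of A/[X].  The additivity of X is what makes [X](a, b)
   closed under sums. *)
Section FactorCategory.
Variables (k : comPzRingType) (A : klincat k) (X : A -> Prop).
Hypothesis addX : additive_cat (fullsub X).

Definition factor_ideal (a b : A) : {pred A a b} :=
  fun f => `[< exists (x : fullsub X) (g : A (sval x) b) (h : A a (sval x)),
                 f = klcomp g h >].

Fact factor_ideal_submod a b : submod_closed (@factor_ideal a b).
Proof.
split=> [|c f f'].
  have [[z _] _] := addX.
  by apply/asboolP; exists z, 0, 0; rewrite klcomp0l.
move=> /asboolP[x [g [h ->]]] /asboolP[x' [g' [h' ->]]].
have [y [i1 [i2 [p1 [p2 [e11 e22 e21 e12]]]]]] :
    exists (y : fullsub X) (i1 : A (sval x) (sval y)) (i2 : A (sval x') (sval y))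
           (p1 : A (sval y) (sval x)) (p2 : A (sval y) (sval x')),
    [/\ klcomp p1 i1 = klid A (sval x), klcomp p2 i2 = klid A (sval x'),
        klcomp p2 i1 = 0 & klcomp p1 i2 = 0].
  have [_ /(_ x x')[y [i1 [i2 [p1 [p2 [*]]]]]]] := addX.
  by exists y, i1, i2, p1, p2.
apply/asboolP; exists y, (c *: klcomp g p1 + klcomp g' p2),
  (klcomp i1 h + klcomp i2 h').
rewrite !klcompDl !klcompDr !klcompZl -!klcompA.
rewrite !(klcompA p1) !(klcompA p2) e11 e22 e21 e12.
by rewrite !klcomp1l !klcomp0l !klcomp0r scaler0 addr0 add0r.
Qed.
HB.instance Definition _ a b :=
  GRing.isSubmodClosed.Build k (A a b) (@factor_ideal a b)
    (factor_ideal_submod a b).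

Definition factor_hom (a b : A) : lmodType k := quotmod (@factor_ideal a b).

End FactorCategory.

Record rmodule (k : comPzRingType) (C : klincat k) := RModule {
  rmod_ob :> C -> zmodType;
  ract : forall x y : C, C x y -> rmod_ob y -> rmod_ob x;
  ract_add : forall x y (f : C x y), {morph ract f : m m' / m + m'};
  ract_addl : forall x y (m : rmod_ob y),
    {morph (fun f : C x y => ract f m) : f g / f + g};
  ract_id : forall x (m : rmod_ob x), ract (klid C x) m = m;
  ract_comp : forall x y z (g : C y z) (f : C x y) (m : rmod_ob z),
    ract (klcomp g f) m = ract f (ract g m)
}.
Arguments ract {k C} _ {x y} f m.

Record lmodule (k : comPzRingType) (C : klincat k) := LModule {
  lmod_ob :> C -> zmodType;
  lact : forall x y : C, C x y -> lmod_ob x -> lmod_ob y;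
  lact_add : forall x y (f : C x y), {morph lact f : m m' / m + m'};
  lact_addl : forall x y (m : lmod_ob x),
    {morph (fun f : C x y => lact f m) : f g / f + g};
  lact_id : forall x (m : lmod_ob x), lact (klid C x) m = m;
  lact_comp : forall x y z (g : C y z) (f : C x y) (m : lmod_ob x),
    lact (klcomp g f) m = lact g (lact f m)
}.
Arguments lact {k C} _ {x y} f m.

Record rmodhom (k : comPzRingType) (C : klincat k) (M N : rmodule C) :=
  RModHom {
    rmodhom_fun :> forall x, {additive M x -> N x};
    rmodhom_nat : forall x y (f : C x y) (m : M y),
      rmodhom_fun x (ract M f m) = ract N f (rmodhom_fun y m)
  }.

(* hom_to b is A(-, b) and hom_from a is A(a, -), both restricted to X. *)
Section Representable.
Variables (k : comPzRingType) (A : klincat k) (X : A -> Prop).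

Definition hom_to (b : A) : rmodule (fullsub X) :=
  @RModule k (fullsub X) (fun x => A (sval x) b)
    (fun x y f m => @klcomp k A _ _ _ m f)
    (fun x y f m m' => @klcompDl k A _ _ _ m m' f)
    (fun x y m f g => @klcompDr k A _ _ _ m f g)
    (fun x m => @klcomp1r k A _ _ m)
    (fun x y z g f m => @klcompA k A _ _ _ _ m g f).

Definition hom_from (a : A) : lmodule (fullsub X) :=
  @LModule k (fullsub X) (fun x => A a (sval x))
    (fun x y f m => @klcomp k A _ _ _ f m)
    (fun x y f m m' => @klcompDr k A _ _ _ f m m')
    (fun x y m f g => @klcompDl k A _ _ _ f g m)
    (fun x m => @klcomp1l k A _ _ m)
    (fun x y z g f m => esym (@klcompA k A _ _ _ _ g f m)).

End Representable.

(* M (x)_C N as an abelian group: the direct sum over x of M x (x)_Z N x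
   modulo m.f (x) n - m (x) f.n.  It is presented in one step, as the free
   abelian group on the triples (x, m, n) modulo the bilinearity relations and
   the relations above. *)
Section Tensor.
Variables (k : comPzRingType) (C : klincat k).
Variables (M : rmodule C) (N : lmodule C).

Definition tensor_sym : choiceType := {classic {x : C & (M x * N x)%type}}.
Definition tensor_free : zmodType := {freeg tensor_sym / int}.
Definition tsym (x : C) (m : M x) (n : N x) : tensor_free :=
  << (existT _ x (m, n) : tensor_sym) >>.

Inductive tensor_rel : tensor_free -> Prop :=
| TensorDl x (m m' : M x) (n : N x) :
    tensor_rel (tsym (m + m') n - (tsym m n + tsym m' n))
| TensorDr x (m : M x) (n n' : N x) :
    tensor_rel (tsym m (n + n') - (tsym m n + tsym m n'))
| TensorBal x y (f : C x y) (m : M y) (n : N x) :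
    tensor_rel (tsym (ract M f m) n - tsym m (lact N f n)).

Definition tensor_ideal : {pred tensor_free} :=
  fun t => `[< forall I : zmodClosed tensor_free,
                 (forall r, tensor_rel r -> r \in I) -> t \in I >].

Fact tensor_ideal_zmod : zmod_closed tensor_ideal.
Proof.
split=> [|t u]; first by apply/asboolP => I _; rewrite rpred0.
move=> /asboolP tI /asboolP uI; apply/asboolP => I Irel.
by rewrite rpredB ?tI ?uI.
Qed.
HB.instance Definition _ :=
  GRing.isZmodClosed.Build tensor_free tensor_ideal tensor_ideal_zmod.

Definition tensor : Type := Quotient.quot tensor_ideal.
HB.instance Definition _ := GRing.Zmodule.on tensor.

Definition tens (x : C) (m : M x) (n : N x) : tensor :=
  \pi_(Quotient.quot tensor_ideal) (tsym m n).

Lemma tensor_rel_eq (t u : tensor_free) : tensor_rel (t - u) ->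
  \pi_(Quotient.quot tensor_ideal) t = \pi_(Quotient.quot tensor_ideal) u.
Proof.
move=> r; apply/eqP; rewrite -(Quotient.idealrBE tensor_ideal).
by apply/asboolP => I; apply.
Qed.

Lemma tensDl x (m m' : M x) (n : N x) : tens (m + m') n = tens m n + tens m' n.
Proof.
by rewrite /tens -raddfD; apply: tensor_rel_eq; exact: TensorDl.
Qed.

Lemma tensDr x (m : M x) (n n' : N x) : tens m (n + n') = tens m n + tens m n'.
Proof.
by rewrite /tens -raddfD; apply: tensor_rel_eq; exact: TensorDr.
Qed.

Lemma tens_bal x y (f : C x y) (m : M y) (n : N x) :
  tens (ract M f m) n = tens m (lact N f n).
Proof. by apply: tensor_rel_eq; exact: TensorBal. Qed.

Lemma tensor_ind (P : tensor -> Prop) :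
  P 0 -> (forall x (m : M x) (n : N x), P (tens m n)) ->
  (forall t u, P t -> P u -> P (t - u)) -> forall t, P t.
Proof.
move=> P0 Ptens PB t; have <- : \pi_(Quotient.quot tensor_ideal) (repr t) = t.
  exact: reprK.
have PN u : P u -> P (- u) by move=> Pu; rewrite -sub0r; exact: PB.
have PD u v : P u -> P v -> P (u + v).
  by move=> Pu /PN Pv; rewrite -[v]opprK; exact: PB.
have Pn u n : P u -> P (u *+ n).
  by move=> Pu; elim: n => // n IHn; rewrite mulrS; exact: PD.
rewrite -[X in P (\pi X)]freeg_sumE raddf_sum.
elim/big_ind: _ => // -[x [m n]] _.
have Pu : P (\pi_(Quotient.quot tensor_ideal) (tsym m n)) by exact: Ptens.
have -> (c : int) : << c *g (existT _ x (m, n) : tensor_sym) >> = tsym m n *~ c.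
  by rewrite /tsym freegU_mulz intz.
by rewrite raddfMz; case: (coeff _ _) => j /=; [exact: Pn | exact/PN/Pn].
Qed.

Section Lift.
Variables (V : zmodType) (b : forall x, M x -> N x -> V).
Hypothesis bDl : forall x (m m' : M x) (n : N x), b (m + m') n = b m n + b m' n.
Hypothesis bDr : forall x (m : M x) (n n' : N x), b m (n + n') = b m n + b m n'.
Hypothesis bbal : forall x y (f : C x y) (m : M y) (n : N x),
  b (ract M f m) n = b m (lact N f n).

Definition tensor_lift_free : tensor_free -> V :=
  @fglift int (zmodule V : lmodType int) tensor_sym (fun s => b (tagged s).1 (tagged s).2).

Fact tensor_lift_free_add : zmod_morphism tensor_lift_free.
Proof. exact: (@lift_is_additive int tensor_sym (zmodule V : lmodType int) _). Qed.
HB.instance Definition _ :=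
  GRing.isZmodMorphism.Build tensor_free V tensor_lift_free tensor_lift_free_add.

Fact tensor_lift_free_sym x (m : M x) (n : N x) :
  tensor_lift_free (tsym m n) = b m n.
Proof. by rewrite /tensor_lift_free /tsym liftU scale1r. Qed.

Fact tensor_lift_ker t : t \in tensor_ideal -> tensor_lift_free t = 0.
Proof.
move=> /asboolP tI; pose I : {pred tensor_free} := [pred t | tensor_lift_free t == 0].
have zI : zmod_closed I.
  split=> [|u v]; rewrite !inE ?raddf0 // => /eqP u0 /eqP v0.
  have -> := tensor_lift_free_add u v. by rewrite u0 v0 subrr.
pose I' : zmodClosed tensor_free :=
  HB.pack I (GRing.isZmodClosed.Build tensor_free I zI).
apply/eqP; apply: (tI I') => r; case=> *.
- by rewrite inE raddfB raddfD /= !tensor_lift_free_sym bDl subrr.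
- by rewrite inE raddfB raddfD /= !tensor_lift_free_sym bDr subrr.
- by rewrite inE raddfB /= !tensor_lift_free_sym bbal subrr.
Qed.

Definition tensor_lift (t : tensor) : V :=
  tensor_lift_free (repr (t : Quotient.quot tensor_ideal)).

Fact tensor_lift_pi t :
  tensor_lift (\pi_(Quotient.quot tensor_ideal) t) = tensor_lift_free t.
Proof.
apply/eqP; rewrite -subr_eq0 -raddfB; apply/eqP/tensor_lift_ker.
by rewrite Quotient.idealrBE reprK.
Qed.

Lemma tensor_lift_tens x (m : M x) (n : N x) : tensor_lift (tens m n) = b m n.
Proof. by rewrite tensor_lift_pi tensor_lift_free_sym. Qed.

Fact tensor_lift_add : zmod_morphism tensor_lift.
Proof.
move=> t u.
have e (v : tensor) : \pi_(Quotient.quot tensor_ideal) (repr v) = v.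
  exact: reprK.
by rewrite -[t]e -[u]e -raddfB !tensor_lift_pi raddfB.
Qed.
HB.instance Definition _ :=
  GRing.isZmodMorphism.Build tensor V tensor_lift tensor_lift_add.

End Lift.

Lemma tensor_ext (V : zmodType) (f g : {additive tensor -> V}) :
  (forall x (m : M x) (n : N x), f (tens m n) = g (tens m n)) -> f =1 g.
Proof.
move=> fg; apply: tensor_ind => [|//|t u ft fu]; first by rewrite !raddf0.
by rewrite !raddfB ft fu.
Qed.

(* C being k-linear, k acts on M (x)_C N through the scalar multiples of the
   identities: c.(m (x) n) = m (x) (c 1_x).n = m.(c 1_x) (x) n. *)
Definition tensor_scale_gen (c : k) (x : C) (m : M x) (n : N x) : tensor :=
  tens m (lact N (c *: klid C x) n).

Fact tensor_scale_genDl c x (m m' : M x) (n : N x) :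
  tensor_scale_gen c (m + m') n = tensor_scale_gen c m n + tensor_scale_gen c m' n.
Proof. exact: tensDl. Qed.

Fact tensor_scale_genDr c x (m : M x) (n n' : N x) :
  tensor_scale_gen c m (n + n') = tensor_scale_gen c m n + tensor_scale_gen c m n'.
Proof. by rewrite /tensor_scale_gen lact_add tensDr. Qed.

Fact tensor_scale_gen_bal c x y (f : C x y) (m : M y) (n : N x) :
  tensor_scale_gen c (ract M f m) n = tensor_scale_gen c m (lact N f n).
Proof.
rewrite /tensor_scale_gen tens_bal -!lact_comp.
by rewrite klcompZl klcompZr klcomp1l klcomp1r.
Qed.

Definition tensor_scale (c : k) : tensor -> tensor :=
  tensor_lift (@tensor_scale_gen c).

Fact tensor_scale_add c : zmod_morphism (tensor_scale c).
Proof.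
apply: tensor_lift_add.
- exact: tensor_scale_genDl.
- exact: tensor_scale_genDr.
- exact: tensor_scale_gen_bal.
Qed.
HB.instance Definition _ c :=
  GRing.isZmodMorphism.Build tensor tensor (tensor_scale c) (tensor_scale_add c).

Fact tensor_scale_tens c x (m : M x) (n : N x) :
  tensor_scale c (tens m n) = tens m (lact N (c *: klid C x) n).
Proof.
apply: tensor_lift_tens.
- exact: tensor_scale_genDl.
- exact: tensor_scale_genDr.
- exact: tensor_scale_gen_bal.
Qed.

Fact tensor_scaleA c d t : tensor_scale c (tensor_scale d t) = tensor_scale (c * d) t.
Proof.
apply: (tensor_ext (f := tensor_scale c \o tensor_scale d)
                   (g := tensor_scale (c * d))) => x m n /=.
by rewrite !tensor_scale_tens -lact_comp klcompZl klcomp1l scalerA.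
Qed.

Fact tensor_scale1 : left_id 1 tensor_scale.
Proof.
move=> t; apply: (tensor_ext (f := tensor_scale 1) (g := idfun)) => x m n /=.
by rewrite tensor_scale_tens scale1r lact_id.
Qed.

Fact tensor_scaleDr : right_distributive tensor_scale +%R.
Proof. by move=> c t u; rewrite raddfD. Qed.

Fact tensor_scaleDl t : {morph tensor_scale^~ t : c d / c + d}.
Proof.
move=> c d; apply: (tensor_ext (f := tensor_scale (c + d))
  (g := tensor_scale c \+ tensor_scale d)) => x m n /=.
by rewrite !tensor_scale_tens scalerDl lact_addl tensDr.
Qed.

HB.instance Definition _ := GRing.Zmodule_isLmodule.Build k tensor
  tensor_scaleA tensor_scale1 tensor_scaleDr tensor_scaleDl.

Lemma tensZ c x (m : M x) (n : N x) :
  c *: tens m n = tens m (lact N (c *: klid C x) n).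
Proof. exact: tensor_scale_tens. Qed.

End Tensor.

Section TensorMaps.
Variables (k : comPzRingType) (C : klincat k).

Fact tensor_lift_linear (M : rmodule C) (N : lmodule C) (V : lmodType k)
    (b : forall x, M x -> N x -> V) :
  (forall x (m m' : M x) (n : N x), b x (m + m') n = b x m n + b x m' n) ->
  (forall x (m : M x) (n n' : N x), b x m (n + n') = b x m n + b x m n') ->
  (forall x y (f : C x y) (m : M y) (n : N x),
     b x (ract M f m) n = b y m (lact N f n)) ->
  (forall c x (m : M x) (n : N x),
     b x m (lact N (c *: klid C x) n) = c *: b x m n) ->
  linear (tensor_lift b).
Proof.
move=> bDl bDr bbal bZ c t u.
have fB : {morph tensor_lift b : t u / t - u}.
  exact: tensor_lift_add bDl bDr bbal.
have f0 : tensor_lift b 0 = 0 by have := fB 0 0; rewrite !subrr.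
have fN v : tensor_lift b (- v) = - tensor_lift b v.
  by rewrite -[- v]sub0r fB f0 sub0r.
have fD v w : tensor_lift b (v + w) = tensor_lift b v + tensor_lift b w.
  by rewrite -{1}[w]opprK fB fN opprK.
rewrite fD; congr (_ + _); move: t.
apply: tensor_ind => [|x m n|v w Pv Pw]; first by rewrite scaler0 f0 scaler0.
  by rewrite tensZ !(tensor_lift_tens bDl bDr bbal) bZ.
by rewrite scalerBr !fB scalerBr Pv Pw.
Qed.

Section TensorMap.
Variables (M M' : rmodule C) (N : lmodule C) (phi : rmodhom M M').

Definition tensor_map : tensor M N -> tensor M' N :=
  tensor_lift (fun x (m : M x) (n : N x) => tens (phi x m) n).

Fact tensor_map_linear : linear tensor_map.
Proof.
apply: tensor_lift_linear => *; rewrite ?tensZ //.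
- by rewrite raddfD tensDl.
- by rewrite tensDr.
- by rewrite rmodhom_nat tens_bal.
Qed.
HB.instance Definition _ :=
  GRing.isLinear.Build k (tensor M N) (tensor M' N) _ tensor_map
    tensor_map_linear.

End TensorMap.
Arguments tensor_map {M M'} N phi.

Definition rmod_epi (M N : rmodule C) (g : rmodhom M N) : Prop :=
  forall x (n : N x), exists m, g x m = n.

Definition rmod_projective (P : rmodule C) : Prop :=
  forall (M N : rmodule C) (g : rmodhom M N) (h : rmodhom P N),
    rmod_epi g -> exists l : rmodhom P M, forall x p, g x (l x p) = h x p.

Record projres (M : rmodule C) := ProjRes {
  pr_ob : nat -> rmodule C;
  pr_d : forall n, rmodhom (pr_ob n.+1) (pr_ob n);
  pr_aug : rmodhom (pr_ob 0) M;
  pr_proj : forall n, rmod_projective (pr_ob n);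
  pr_aug_epi : rmod_epi pr_aug;
  pr_exact0 : forall x (p : pr_ob 0 x),
    pr_aug x p = 0 <-> exists q, pr_d 0 x q = p;
  pr_exact : forall n x (p : pr_ob n.+1 x),
    pr_d n x p = 0 <-> exists q, pr_d n.+1 x q = p
}.

(* Tor_n(M, N) as the n-th left derived functor of - (x)_C N, computed from a
   projective resolution P of M. *)
Definition Tor (n : nat) (M : rmodule C) (P : projres M) (N : lmodule C) :
    lmodType k :=
  match n with
  | 0 => homology (tensor_map N (pr_d P 0))
           (\0 : {linear tensor (pr_ob P 0) N -> tensor (pr_ob P 0) N})
  | n'.+1 => homology (tensor_map N (pr_d P n'.+1)) (tensor_map N (pr_d P n'))
  end.

End TensorMaps.

Section CanonicalMap.
Variables (k : comPzRingType) (A : klincat k) (X : A -> Prop) (a b : A).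

Definition can : tensor (hom_to X b) (hom_from X a) -> A a b :=
  tensor_lift (fun (x : fullsub X) (g : hom_to X b x) (f : hom_from X a x) =>
    @klcomp k A a (sval x) b g f).

Fact can_linear : linear can.
Proof.
apply: tensor_lift_linear => *.
- exact: klcompDl.
- exact: klcompDr.
- by rewrite /= klcompA.
- by rewrite /= klcompZl klcomp1l klcompZr.
Qed.
HB.instance Definition _ := GRing.isLinear.Build k
  (tensor (hom_to X b) (hom_from X a)) (A a b) _ can can_linear.

Lemma can_tens (x : fullsub X) (g : A (sval x) b) (f : A a (sval x)) :
  can (tens (g : hom_to X b x) (f : hom_from X a x)) = klcomp g f.
Proof.
apply: tensor_lift_tens => *.
- exact: klcompDl.
- exact: klcompDr.
- by rewrite /= klcompA.
Qed.

End CanonicalMap.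
Arguments can {k A} X a b _.

(* Graded and dg categories with a fixed class of objects, cohomologically
   graded.  The degree of a composite is only required to be provably equal to
   i + j, which avoids transports in the axioms. *)
Record grcat (k : comPzRingType) (Ob : Type) := GrCat {
  grhom :> Ob -> Ob -> int -> lmodType k;
  grid : forall a, grhom a a 0;
  grcomp : forall a b c i j n, i + j = n ->
    grhom b c i -> grhom a b j -> grhom a c n;
  grcompA : forall a b c d i j l ij jl n
      (eij : i + j = ij) (ejl : j + l = jl)
      (e : i + jl = n) (e' : ij + l = n)
      (h : grhom c d i) (g : grhom b c j) (f : grhom a b l),
    grcomp e h (grcomp ejl g f) = grcomp e' (grcomp eij h g) f;
  grcomp1l : forall a b i (e : 0 + i = i) (f : grhom a b i),
    grcomp e (grid b) f = f;
  grcomp1r : forall a b i (e : i + 0 = i) (f : grhom a b i),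
    grcomp e f (grid a) = f;
  grcomp_linl : forall a b c i j n (e : i + j = n) (f : grhom a b j),
    linear (fun g : grhom b c i => grcomp e g f);
  grcomp_linr : forall a b c i j n (e : i + j = n) (g : grhom b c i),
    linear (fun f : grhom a b j => grcomp e g f)
}.
Arguments grid {k Ob} _ _.
Arguments grcomp {k Ob _ a b c i j n} e g f.

Record dgcat (k : comPzRingType) (Ob : Type) := DgCat {
  dg_gr :> grcat k Ob;
  dgd : forall a b i j, i + 1 = j -> {linear dg_gr a b i -> dg_gr a b j};
  dgdd : forall a b i j l (e : i + 1 = j) (e' : j + 1 = l) (f : dg_gr a b i),
    dgd a b e' (dgd a b e f) = 0;
  dg_leibniz : forall a b c i j n i' j' n'
      (e : i + j = n) (ei : i + 1 = i') (ej : j + 1 = j') (en : n + 1 = n')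
      (e1 : i' + j = n') (e2 : i + j' = n')
      (g : dg_gr b c i) (f : dg_gr a b j),
    dgd a c en (grcomp e g f) =
      grcomp e1 (dgd b c ei g) f + (-1) ^+ absz i *: grcomp e2 g (dgd a b ej f)
}.
Arguments dgd {k Ob} _ {a b i j} e.

Record grfunctor (k : comPzRingType) (Ob : Type) (B C : grcat k Ob) :=
  GrFunctor {
    grf_map :> forall a b i, {linear B a b i -> C a b i};
    grf_id : forall a, grf_map a a 0 (grid B a) = grid C a;
    grf_comp : forall a b c i j n (e : i + j = n) (g : B b c i) (f : B a b j),
      grf_map a c n (grcomp e g f) = grcomp e (grf_map b c i g) (grf_map a b j f)
  }.

Record dgfunctor (k : comPzRingType) (Ob : Type) (B C : dgcat k Ob) :=
  DgFunctor {
    dgf_gr :> grfunctor B C;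
    dgf_d : forall a b i j (e : i + 1 = j) (f : B a b i),
      dgf_gr a b j (dgd B e f) = dgd C e (dgf_gr a b i f)
  }.

Definition dgcohomology (k : comPzRingType) (Ob : Type) (C : dgcat k Ob)
    (a b : Ob) (n : int) : lmodType k :=
  homology (@dgd k Ob C a b (n - 1) n (subrK 1 n))
           (@dgd k Ob C a b n (n + 1) erefl).

Definition nonpositively_graded (k : comPzRingType) (Ob : Type)
    (C : grcat k Ob) (a b : Ob) : Prop :=
  forall (i : int) (f : C a b i), 0 < i -> f = 0.

(* The two conditions are the injectivity and the surjectivity of the map
   induced on the cohomology in degree j. *)
Definition quasi_isomorphism (k : comPzRingType) (Ob : Type)
    (B C : dgcat k Ob) (F : dgfunctor B C) : Prop :=
  forall (a b : Ob) (i j l : int) (e : i + 1 = j) (e' : j + 1 = l),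
    (forall f : B a b j, dgd B e' f = 0 ->
       (exists h, dgd C e h = F a b j f) -> exists h, dgd B e h = f) /\
    (forall g : C a b j, dgd C e' g = 0 ->
       exists (f : B a b j) (h : C a b i),
         dgd B e' f = 0 /\ g = F a b j f + dgd C e h).

Section DegreeZero.
Variables (k : comPzRingType) (A : klincat k).

Definition deg0_hom (a b : A) (i : int) : lmodType k :=
  match i with Posz 0 => A a b | _ => 'rV[k]_0 end.

Definition deg0_comp (a b c : A) (i j n : int) (e : i + j = n) :
    deg0_hom b c i -> deg0_hom a b j -> deg0_hom a c n :=
  match i, j, n
    return deg0_hom b c i -> deg0_hom a b j -> deg0_hom a c n with
  | Posz 0, Posz 0, Posz 0 => fun g f => klcomp g f
  | _, _, _ => fun _ _ => 0
  end.

Lemma deg0_eq0 a b i (f : deg0_hom a b i) : i != 0 -> f = 0.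
Proof. by case: i f => [[|i]|i] f //= _; apply/rowP; case. Qed.

Lemma deg0_comp0l a b c i j n (e : i + j = n) (f : deg0_hom a b j) :
  deg0_comp e (0 : deg0_hom b c i) f = 0.
Proof.
by case: i j n e f => [[|i]|i] [[|j]|j] [[|n]|n] e f //=; rewrite klcomp0l.
Qed.

Lemma deg0_comp0r a b c i j n (e : i + j = n) (g : deg0_hom b c i) :
  deg0_comp e g (0 : deg0_hom a b j) = 0.
Proof.
by case: i j n e g => [[|i]|i] [[|j]|j] [[|n]|n] e g //=; rewrite klcomp0r.
Qed.

Fact deg0_compA (a b c d : A) i j l ij jl n
    (eij : i + j = ij) (ejl : j + l = jl) (e : i + jl = n) (e' : ij + l = n)
    (h : deg0_hom c d i) (g : deg0_hom b c j) (f : deg0_hom a b l) :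
  deg0_comp e h (deg0_comp ejl g f) = deg0_comp e' (deg0_comp eij h g) f.
Proof.
have [i0|i0] := eqVneq i 0; last by rewrite [h]deg0_eq0 // !deg0_comp0l.
have [j0|j0] := eqVneq j 0.
  2: by rewrite [g]deg0_eq0 // !(deg0_comp0l, deg0_comp0r).
have [l0|l0] := eqVneq l 0; last by rewrite [f]deg0_eq0 // !deg0_comp0r.
subst i j l ij jl n; have -> : e' = erefl by exact: eq_irrelevance.
exact: klcompA.
Qed.

Fact deg0_comp1l (a b : A) i (e : 0 + i = i) (f : deg0_hom a b i) :
  deg0_comp e (klid A b : deg0_hom b b 0) f = f.
Proof.
have [i0|i0] := eqVneq i 0; last by rewrite [f]deg0_eq0 // deg0_comp0r.
by subst i; exact: klcomp1l.
Qed.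

Fact deg0_comp1r (a b : A) i (e : i + 0 = i) (f : deg0_hom a b i) :
  deg0_comp e f (klid A a : deg0_hom a a 0) = f.
Proof.
have [i0|i0] := eqVneq i 0; last by rewrite [f]deg0_eq0 // deg0_comp0l.
by subst i; exact: klcomp1r.
Qed.

Fact deg0_comp_linl (a b c : A) i j n (e : i + j = n) (f : deg0_hom a b j) :
  linear (fun g : deg0_hom b c i => deg0_comp e g f).
Proof.
move=> x g g'; have [i0|i0] := eqVneq i 0; last first.
  by rewrite [g]deg0_eq0 // [g']deg0_eq0 // scaler0 addr0 deg0_comp0l scaler0 addr0.
have [j0|j0] := eqVneq j 0.
  by subst i j n; exact: klcomp_linl.
by rewrite [f]deg0_eq0 // !deg0_comp0r scaler0 addr0.
Qed.

Fact deg0_comp_linr (a b c : A) i j n (e : i + j = n) (g : deg0_hom b c i) :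
  linear (fun f : deg0_hom a b j => deg0_comp e g f).
Proof.
move=> x f f'; have [j0|j0] := eqVneq j 0; last first.
  by rewrite [f]deg0_eq0 // [f']deg0_eq0 // scaler0 addr0 deg0_comp0r scaler0 addr0.
have [i0|i0] := eqVneq i 0.
  by subst i j n; exact: klcomp_linr.
by rewrite [g]deg0_eq0 // !deg0_comp0l scaler0 addr0.
Qed.

Definition deg0_gr : grcat k A :=
  @GrCat k A deg0_hom (fun a => klid A a) deg0_comp deg0_compA
    deg0_comp1l deg0_comp1r deg0_comp_linl deg0_comp_linr.

Definition deg0_d (a b : A) i j (_ : i + 1 = j) :
  {linear deg0_gr a b i -> deg0_gr a b j} := \0.

Fact deg0_dd (a b : A) i j l (e : i + 1 = j) (e' : j + 1 = l)
  (f : deg0_gr a b i) : deg0_d a b e' (deg0_d a b e f) = 0.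
Proof. by []. Qed.

Fact deg0_leibniz (a b c : A) i j n i' j' n'
    (e : i + j = n) (ei : i + 1 = i') (ej : j + 1 = j') (en : n + 1 = n')
    (e1 : i' + j = n') (e2 : i + j' = n')
    (g : deg0_gr b c i) (f : deg0_gr a b j) :
  deg0_d a c en (grcomp e g f) =
    grcomp e1 (deg0_d b c ei g) f
    + (-1) ^+ absz i *: grcomp e2 g (deg0_d a b ej f).
Proof.
by rewrite /= [deg0_comp e1 _ _]deg0_comp0l deg0_comp0r scaler0 addr0.
Qed.

Definition deg0 : dgcat k A :=
  @DgCat k A deg0_gr deg0_d deg0_dd deg0_leibniz.

End DegreeZero.

Record genfam (Ob : Type) := GenFam {
  gen :> Type;
  gsrc : gen -> Ob;
  gtgt : gen -> Ob;
  gdeg : gen -> int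
}.

(* C is freely generated over B, as a graded k-category, by the morphisms x g.
   Target categories D with another class of objects reduce to this case by
   pulling D back along the map on objects. *)
Definition freely_generated (k : comPzRingType) (Ob : Type) (B C : grcat k Ob)
    (F : grfunctor B C) (G : genfam Ob)
    (x : forall g : G, C (gsrc g) (gtgt g) (gdeg g)) : Prop :=
  forall (D : grcat k Ob) (Phi : grfunctor B D)
      (y : forall g : G, D (gsrc g) (gtgt g) (gdeg g)),
    let extends (Psi : grfunctor C D) :=
      (forall a b i (f : B a b i), Psi a b i (F a b i f) = Phi a b i f) /\
      (forall g, Psi _ _ _ (x g) = y g) in
    (exists Psi, extends Psi) /\
    (forall Psi Psi', extends Psi -> extends Psi' ->
       forall a b i (f : C a b i), Psi a b i f = Psi' a b i f).

Definition discrete_grcat (k : comPzRingType) (Ob : Type) (C : grcat k Ob) :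
    Prop :=
  (forall a, bijective (fun c : k => c *: grid C a)) /\
  (forall a b i (f : C a b i), ~ (a = b /\ i = 0) -> f = 0).

(* Drinfeld's definition: C is the union of an increasing sequence of dg
   subcategories E n, where E 0 is discrete and E n.+1 is freely generated over
   E n, as a graded category, by homogeneous morphisms whose differentials lie
   in E n. *)
Definition semi_free (k : comPzRingType) (Ob : Type) (C : dgcat k Ob) : Prop :=
  exists (E : nat -> dgcat k Ob) (J : forall n, dgfunctor (E n) (E n.+1))
      (I : forall n, dgfunctor (E n) C),
    [/\ discrete_grcat (E 0),
        forall n a b i (f : E n a b i), I n.+1 a b i (J n a b i f) = I n a b i f,
        forall n a b i, injective (I n a b i),
        forall a b i (f : C a b i), exists n (f' : E n a b i), I n a b i f' = f &
        forall n, exists (G : genfam Ob)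
            (x : forall g : G, E n.+1 (gsrc g) (gtgt g) (gdeg g)),
          freely_generated (J n) x /\
          forall g j (e : gdeg g + 1 = j),
            exists f, dgd (E n.+1) e (x g) = J n _ _ j f].

(* The non-positivity of the Hom complexes does not follow from the other
   conditions; it holds for the resolutions built from generators of
   non-positive degree, as one does for A in degree zero. *)
Record semifree_resolution (k : comPzRingType) (A : klincat k) :=
  SemifreeResolution {
    sfr_cat :> dgcat k A;
    sfr_pi : dgfunctor sfr_cat (deg0 A);
    sfr_semi_free : semi_free sfr_cat;
    sfr_qis : quasi_isomorphism sfr_pi;
    sfr_nonpos : forall a b, nonpositively_graded sfr_cat a b
  }.

Definition contracting_fam (Ob : Type) (X : Ob -> Prop) : genfam Ob :=
  @GenFam Ob {x : Ob | X x} sval sval (fun _ => -1).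

(* The dg quotient of C by its full dg subcategory on the objects in X: an
   endomorphism eps_x of degree -1 with d(eps_x) = 1 is freely adjoined for
   each x in X. *)
Record dg_quotient (k : comPzRingType) (Ob : Type) (C : dgcat k Ob)
    (X : Ob -> Prop) := DgQuotient {
  dgq_cat :> dgcat k Ob;
  dgq_functor : dgfunctor C dgq_cat;
  dgq_eps : forall x : {x : Ob | X x}, dgq_cat (sval x) (sval x) (-1);
  dgq_free : freely_generated dgq_functor (G := contracting_fam X) dgq_eps;
  dgq_d_eps : forall x, dgd dgq_cat (addNr 1) (dgq_eps x) = grid dgq_cat (sval x)
}.

(* Main.v *)
From HB Require Import structures.
Require Import Defs.
From mathcomp Require Import all_boot all_order all_algebra zify.
From mathcomp Require Import boolp functions.

Set Implicit Arguments.
Unset Strict Implicit.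
Unset Printing Implicit Defensive.

Import Order.TTheory GRing.Theory Num.Theory.
Local Open Scope ring_scope.

(** Let C be the resolution of A, pi : C -> A its augmentation, Q = C/X the dg
quotient and F : C -> Q the canonical functor, and fix the object b.  The
cohomology of Q(a, b) is determined by two properties of the right dg C-module
Q(-, b).

The first is freeness.  As a graded category C is free on some letters, and Q is
free on the same letters together with the endomorphisms eps_x; hence the words
in these letters form a k-basis of Q(a, b).  Cutting a word just after its
rightmost eps_x writes it uniquely as p v, where p is empty or ends with some
eps_x and v is a word of C.  The words p are therefore a basis of Q(-, b) over C
([right_basis_of]): the empty one sits at b in degree 0, the others sit at objects
of X in negative degrees.  Since C lives in degrees <= 0, the differential of a
basis word only involves basis words of strictly larger degree
([bcoord_d_lead]).  Filtering by the degree of the basis word thus shows that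
replacing the coefficients in C by coefficients in A is a quasi-isomorphism
([coord_ker_exact], [homology_red]).

The resulting complex is A(a, b) in degree 0, preceded in degree -n-1 by the
module with one copy of A(a, x) for each basis word of degree -n-1 sitting at x.
These are projective X-modules in the variable a ([red_rmod_projective]), and
their value at any a is their tensor product with A(a, -)
([mu_inj], [mu_surj]).

The second property is that right composition with eps_x contracts Q(x, b) for x
in X, as d(eps_x) = 1.  On X the complex above is therefore exact, so that its
part of negative degree is a projective resolution P of A(-, b)
([red_projres]), and Q(a, b) is quasi-isomorphic to the cone of
P (x)_X A(a, -) -> A(a, b).  The three statements compute the cohomology of this
cone: the cokernel of the last map is A(a, b) modulo the morphisms factoring
through X, right exactness of the tensor product turns degree -1 into the kernel
of can, and from degree -2 on one finds Tor, which does not depend on the chosen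
resolution ([Tor_unique]).

The basis is extracted from the universal properties alone.  Words span because
the morphisms that they span form a subcategory containing the generators
([freely_generated_ind]).  Coordinates exist because a free category acts on the
functions of words by translation, and a functor from Q to this category of
operators evaluates the coefficient of a word ([op_cat]). *)

(** * Finite sums and submodules *)

Lemma big_supp (V : zmodType) (I : choiceType) (s s' : seq I) (F : I -> V) :
  uniq s -> uniq s' -> (forall i, i \notin s -> F i = 0) ->
  (forall i, i \notin s' -> F i = 0) -> \sum_(i <- s) F i = \sum_(i <- s') F i.
Proof.
move=> us us' s0 s'0.
have sum_restr (t t' : seq I) : uniq t -> uniq t' -> (forall i, i \notin t' -> F i = 0) ->
    \sum_(i <- t) F i = \sum_(i <- t | i \in t') F i.
  move=> ut ut' t0; rewrite (bigID (mem t')) /= [X in _ + X]big1 ?addr0 //.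
rewrite (sum_restr _ _ us us') // (sum_restr _ _ us' us) // -[LHS]big_filter -[RHS]big_filter.
apply: perm_big; apply: uniq_perm; rewrite ?filter_uniq // => i.
by rewrite !mem_filter andbC.
Qed.

Lemma sum_pmap_id (V : zmodType) (T : eqType) (s : seq (option T)) (G : option T -> V) :
  G None = 0 -> \sum_(p <- s) G p = \sum_(t <- pmap id s) G (Some t).
Proof.
move=> G0; elim: s => [|[t|] s IHs]; rewrite ?big_nil // big_cons IHs.
  by rewrite big_cons.
by rewrite G0 add0r.
Qed.

Section Submodule.
Variables (k : pzRingType) (V : lmodType k) (S : submodClosed V).

Record submod : Type := SubMod { submod_val : V; submod_valP : submod_val \in S }.
HB.instance Definition _ := [isSub for submod_val].
HB.instance Definition _ := [Choice of submod by <:].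
HB.instance Definition _ := [SubChoice_isSubLmodule of submod by <:].

Lemma submod_inj (u v : submod) : submod_val u = submod_val v -> u = v.
Proof. exact: val_inj. Qed.

End Submodule.

(** * Graded categories and their subcategories *)

Section GradedCategories.
Variables (k : comPzRingType) (Ob : Type) (H : grcat k Ob).

Lemma grcompDl (a b c : Ob) i j n (e : i + j = n) (g g' : H b c i) (f : H a b j) :
  grcomp e (g + g') f = grcomp e g f + grcomp e g' f.
Proof. by have := grcomp_linl e f 1 g g'; rewrite !scale1r. Qed.
Lemma grcompDr (a b c : Ob) i j n (e : i + j = n) (g : H b c i) (f f' : H a b j) :
  grcomp e g (f + f') = grcomp e g f + grcomp e g f'.
Proof. by have := grcomp_linr e g 1 f f'; rewrite !scale1r. Qed.
Lemma grcomp0l (a b c : Ob) i j n (e : i + j = n) (f : H a b j) :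
  grcomp e (0 : H b c i) f = 0.
Proof. by apply: (addrI (grcomp e 0 f)); rewrite -grcompDl !addr0. Qed.
Lemma grcomp0r (a b c : Ob) i j n (e : i + j = n) (g : H b c i) :
  grcomp e g (0 : H a b j) = 0.
Proof. by apply: (addrI (grcomp e g 0)); rewrite -grcompDr !addr0. Qed.
Lemma grcompZl (a b c : Ob) i j n (e : i + j = n) l (g : H b c i) (f : H a b j) :
  grcomp e (l *: g) f = l *: grcomp e g f.
Proof. by have := grcomp_linl e f l g 0; rewrite !addr0 grcomp0l addr0. Qed.
Lemma grcompZr (a b c : Ob) i j n (e : i + j = n) l (g : H b c i) (f : H a b j) :
  grcomp e g (l *: f) = l *: grcomp e g f.
Proof. by have := grcomp_linr e g l f 0; rewrite !addr0 grcomp0r addr0. Qed.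
Lemma grcompNr (a b c : Ob) i j n (e : i + j = n) (g : H b c i) (f : H a b j) :
  grcomp e g (- f) = - grcomp e g f.
Proof. by rewrite -scaleN1r grcompZr scaleN1r. Qed.
Lemma grcompBr (a b c : Ob) i j n (e : i + j = n) (g : H b c i) (f f' : H a b j) :
  grcomp e g (f - f') = grcomp e g f - grcomp e g f'.
Proof. by rewrite grcompDr grcompNr. Qed.
Lemma grcomp_suml (I : Type) (s : seq I) (a b c : Ob) i j n (e : i + j = n)
    (g : I -> H b c i) (f : H a b j) :
  grcomp e (\sum_(x <- s) g x) f = \sum_(x <- s) grcomp e (g x) f.
Proof.
elim: s => [|x s IHs]; first by rewrite !big_nil grcomp0l.
by rewrite !big_cons grcompDl IHs.
Qed.

Definition subcategory (S : forall a b i, H a b i -> Prop) : Prop :=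
  [/\ forall a b i, S a b i 0,
      forall a b i l (f g : H a b i), S _ _ _ f -> S _ _ _ g -> S _ _ _ (l *: f + g),
      forall a, S a a 0 (grid H a) &
      forall a b c i j n (e : i + j = n) (g : H b c i) (f : H a b j),
        S _ _ _ g -> S _ _ _ f -> S _ _ _ (grcomp e g f)].

Section Subcategory.
Variable (S : forall a b i, H a b i -> Prop).
Hypothesis subS : subcategory S.

Definition subcat_pred a b i : {pred H a b i} := fun f => `[< @S a b i f >].
Fact subcat_pred_submod a b i : submod_closed (@subcat_pred a b i).
Proof.
have [S0 SD _ _] := subS.
split; first exact/asboolP/S0.
by move=> c f g /asboolP Sf /asboolP Sg; apply/asboolP/SD.
Qed.
HB.instance Definition _ a b i :=
  GRing.isSubmodClosed.Build k (H a b i) (@subcat_pred a b i)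
    (subcat_pred_submod a b i).

Definition subcat_hom a b i : lmodType k := submod (@subcat_pred a b i).

Lemma subcat_homP a b i (f : subcat_hom a b i) : S (val f).
Proof. exact/asboolP/(submod_valP f). Qed.

Definition subcat_mk a b i (f : H a b i) (Sf : @S a b i f) : subcat_hom a b i :=
  SubMod (introT (asboolP _) Sf : f \in @subcat_pred a b i).

Definition subcat_comp a b c i j n (e : i + j = n)
    (g : subcat_hom b c i) (f : subcat_hom a b j) : subcat_hom a c n :=
  subcat_mk (let: And4 _ _ _ SM := subS in
             SM a b c i j n e _ _ (subcat_homP g) (subcat_homP f)).

Definition subcat_id a : subcat_hom a a 0 :=
  subcat_mk (let: And4 _ _ S1 _ := subS in S1 a).

Definition subcat : grcat k Ob.
Proof.
apply: (@GrCat k Ob subcat_hom subcat_id subcat_comp).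
- by move=> *; apply: submod_inj; exact: grcompA.
- by move=> *; apply: submod_inj; exact: grcomp1l.
- by move=> *; apply: submod_inj; exact: grcomp1r.
- by move=> a b c i j n e f l g g'; apply: submod_inj; exact: grcomp_linl.
- by move=> a b c i j n e g l f f'; apply: submod_inj; exact: grcomp_linr.
Defined.

Fact subcat_val_linear a b i : linear (val : subcat_hom a b i -> H a b i).
Proof. by []. Qed.
HB.instance Definition _ a b i :=
  GRing.isLinear.Build k (subcat_hom a b i) (H a b i) _ val (@subcat_val_linear a b i).

Definition subcat_incl : grfunctor subcat H :=
  @GrFunctor k Ob subcat H (fun a b i => val : {linear subcat_hom a b i -> H a b i})
    (fun=> erefl) (fun _ _ _ _ _ _ _ _ _ => erefl).

End Subcategory.

End GradedCategories.

Section GradedFunctors.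
Variables (k : comPzRingType) (Ob : Type) (B C : grcat k Ob) (F : grfunctor B C).

Lemma grf0 a b i : F a b i 0 = 0. Proof. exact: linear0. Qed.
Lemma grfP a b i l (f g : B a b i) : F a b i (l *: f + g) = l *: F a b i f + F a b i g.
Proof. exact: linearP. Qed.
Lemma grfD a b i (f g : B a b i) : F a b i (f + g) = F a b i f + F a b i g.
Proof. exact: linearD. Qed.
Lemma grfZ a b i l (f : B a b i) : F a b i (l *: f) = l *: F a b i f.
Proof. exact: linearZ. Qed.
Lemma grfB a b i (f g : B a b i) : F a b i (f - g) = F a b i f - F a b i g.
Proof. exact: linearB. Qed.

End GradedFunctors.

Definition grfunctor_comp (k : comPzRingType) (Ob : Type) (B C D : grcat k Ob)
    (Phi : grfunctor C D) (Psi : grfunctor B C) : grfunctor B D.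
Proof.
apply: (@GrFunctor k Ob B D (fun a b i => Phi a b i \o Psi a b i)).
- by move=> a /=; rewrite !grf_id.
- by move=> *; rewrite /= !grf_comp.
Defined.

Definition grfunctor_id (k : comPzRingType) (Ob : Type) (B : grcat k Ob) :
  grfunctor B B := @GrFunctor k Ob B B (fun a b i => idfun) (fun=> erefl)
    (fun _ _ _ _ _ _ _ _ _ => erefl).

(** The generators can be corestricted to the subcategory defined by [S], so the
universal property yields a functor from C to that subcategory.  Composed with the
inclusion it extends the generators of C, as the identity does; by uniqueness every
morphism of C comes from the subcategory. *)
Lemma freely_generated_ind (k : comPzRingType) (Ob : Type) (B C : grcat k Ob)
    (F : grfunctor B C) (G : genfam Ob)
    (x : forall g : G, C (gsrc g) (gtgt g) (gdeg g))
    (S : forall a b i, C a b i -> Prop) :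
  freely_generated F x -> subcategory S ->
  (forall a b i (f : B a b i), S _ _ _ (F a b i f)) ->
  (forall g, S _ _ _ (x g)) -> forall a b i (f : C a b i), S _ _ _ f.
Proof.
move=> free subS SF Sx a b i f.
pose m a b i (f : B a b i) : subcat subS a b i := subcat_mk subS (SF a b i f).
have m_linear a' b' i' : linear (m a' b' i').
  by move=> c u v; apply: submod_inj; rewrite /= linearP.
pose M a' b' i' : {linear B a' b' i' -> subcat subS a' b' i'} :=
  HB.pack (m a' b' i') (GRing.isLinear.Build _ _ _ _ _ (m_linear a' b' i')).
have Mid a' : M a' a' 0 (grid B a') = grid (subcat subS) a'.
  by apply: submod_inj; rewrite /= grf_id.
have Mcomp a' b' c' i' j' n' (e : i' + j' = n') (g : B b' c' i') (h : B a' b' j') :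
    M a' c' n' (grcomp e g h) = grcomp e (M b' c' i' g) (M a' b' j' h).
  by apply: submod_inj; rewrite /= grf_comp.
have [[R [RF Rx]] _] := free (subcat subS) (GrFunctor Mid Mcomp)
  (fun g => subcat_mk subS (Sx g)).
have [_ uniqF] := free C F x.
have -> : f = subcat_incl subS a b i (R a b i f).
  apply: (uniqF (grfunctor_id C) (grfunctor_comp (subcat_incl subS) R)) => //.
  by split=> [a' b' i' h|g]; rewrite /= ?RF ?Rx.
exact: subcat_homP.
Qed.

(** * Free generation of semi-free categories *)

(** The bottom of the tower defining a semi-free category maps to every graded
category: each of its morphisms is a scalar multiple of an identity, for a unique
scalar, or zero. *)
Lemma discrete_functor (k : comPzRingType) (Ob : Type) (B D : grcat k Ob) :
  discrete_grcat B -> inhabited (grfunctor B D).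
Proof.
move=> [unit_bij off].
have inv_ex (a : Ob) : exists v : B a a 0 -> k,
    cancel (fun c : k => c *: grid B a) v /\ cancel v (fun c : k => c *: grid B a).
  by case: (unit_bij a) => v vK Kv; exists v.
pose inv a := sval (cid (inv_ex a)).
have inv_spec a := svalP (cid (inv_ex a)).
have invK a : cancel (fun c : k => c *: grid B a) (inv a) by case: (inv_spec a).
have Kinv a f : inv a f *: grid B a = f by case: (inv_spec a) => _; apply.
(* The scalar multiple is transported along proofs of a = b and of 0 = i. *)
pose m a b i : B a b i -> D a b i :=
  match pselect (a = b), pselect (0 = i) with
  | left e, left e0 =>
      match e in _ = b, e0 in _ = i return B a b i -> D a b i with
        erefl, erefl => fun f => inv a f *: grid D a end
  | _, _ => fun=> 0
  end.
have mE a f : m a a 0 f = inv a f *: grid D a.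
  rewrite /m; case: pselect => // e; case: pselect => // e0.
  by rewrite (Prop_irrelevance e erefl) (Prop_irrelevance e0 erefl).
have m0 a b i f : ~ (a = b /\ i = 0) -> m a b i f = 0.
  by rewrite /m; case: pselect => // e; case: pselect => // e0 [].
have m_linear a b i : linear (m a b i).
  move=> c f g; have [[e e0]|n] := pselect (a = b /\ i = 0).
    subst b i; rewrite !mE scalerA -scalerDl; congr (_ *: _).
    apply: (can_inj (invK a)).
    by rewrite Kinv scalerDl -scalerA !Kinv.
  by rewrite !m0 // scaler0 addr0.
pose M a b i : {linear B a b i -> D a b i} :=
  HB.pack (m a b i) (GRing.isLinear.Build _ _ _ _ _ (m_linear a b i)).
have Mz a b i : m a b i 0 = 0 := linear0 (M a b i).
have MZ a b i c f : m a b i (c *: f) = c *: m a b i f := linearZ_LR (M a b i) c f.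
have inv1 a : inv a (grid B a) = 1 by rewrite -[grid B a]scale1r invK.
have Mid a : M a a 0 (grid B a) = grid D a by rewrite /= mE inv1 scale1r.
suff Mcomp a b c i j n (e : i + j = n) (g : B b c i) (f : B a b j) :
    M a c n (grcomp e g f) = grcomp e (M b c i g) (M a b j f).
  by constructor; exact: (GrFunctor Mid Mcomp).
rewrite /=; have [[eb e0]|n1] := pselect (b = c /\ i = 0); last first.
  by rewrite (off _ _ _ g) // (m0 _ _ _ _ n1) !grcomp0l Mz.
have [[ea e0']|n2] := pselect (a = b /\ j = 0); last first.
  by rewrite (off _ _ _ f) // (m0 _ _ _ _ n2) !grcomp0r Mz.
subst b c i j; have n0 : n = 0 by rewrite -e addr0.
subst n; rewrite -{1}(Kinv _ g) -{1}(Kinv _ f) !mE !grcompZl !grcompZr.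
by rewrite -[LHS]mE !MZ !grcomp1l mE inv1 scale1r.
Qed.

Definition generates (k : comPzRingType) (Ob : Type) (C : grcat k Ob)
    (G : genfam Ob) (x : forall g : G, C (gsrc g) (gtgt g) (gdeg g)) : Prop :=
  forall S : forall a b i, C a b i -> Prop, subcategory S ->
    (forall g, S _ _ _ (x g)) -> forall a b i (f : C a b i), S _ _ _ f.

(** The universal property of the free graded category on the family [x], with
uniqueness of the extensions replaced by generation. *)
Definition free_on (k : comPzRingType) (Ob : Type) (C : grcat k Ob)
    (G : genfam Ob) (x : forall g : G, C (gsrc g) (gtgt g) (gdeg g)) : Prop :=
  generates x /\
  forall (D : grcat k Ob) (y : forall g : G, D (gsrc g) (gtgt g) (gdeg g)),
    exists Psi : grfunctor C D, forall g, Psi _ _ _ (x g) = y g.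

Lemma subcategory_preim (k : comPzRingType) (Ob : Type) (B C : grcat k Ob)
    (F : grfunctor B C) (S : forall a b i, C a b i -> Prop) :
  subcategory S -> subcategory (fun a b i f => S a b i (F a b i f)).
Proof.
move=> [S0 SD S1 SM]; split=> [a b i|a b i l f g Sf Sg|a|a b c i j n e g f Sg Sf].
- by rewrite linear0.
- by rewrite linearP; exact: SD.
- by rewrite grf_id.
- by rewrite grf_comp; exact: SM.
Qed.

Section Tower.
Variables (k : comPzRingType) (Ob : Type) (C : grcat k Ob).
Variables (E : nat -> grcat k Ob) (J : forall n, grfunctor (E n) (E n.+1)).
Variable I : forall n, grfunctor (E n) C.
Hypothesis E0 : discrete_grcat (E 0).
Hypothesis IJ : forall n a b i (f : E n a b i), I n.+1 a b i (J n a b i f) = I n a b i f.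
Hypothesis I_inj : forall n a b i, injective (I n a b i).
Hypothesis I_surj : forall a b i (f : C a b i), exists n (f' : E n a b i), I n a b i f' = f.
Variables (G : nat -> genfam Ob).
Variable x : forall n (g : G n), E n.+1 (gsrc g) (gtgt g) (gdeg g).
Hypothesis free : forall n, freely_generated (J n) (@x n).

Definition tower_fam : genfam Ob :=
  @GenFam Ob {n & G n} (fun g => gsrc (projT2 g)) (fun g => gtgt (projT2 g))
    (fun g => gdeg (projT2 g)).

Definition tower_gen (g : tower_fam) : C (gsrc g) (gtgt g) (gdeg g) :=
  I (projT1 g).+1 _ _ _ (x (projT2 g)).

Lemma tower_generates : generates tower_gen.
Proof.
move=> S subS Sx a b i f; have [n [f' <-]] := I_surj f.
clear f; elim: n => [|n IHn] in a b i f' *.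
  have [unit_bij off] := E0; have [S0 SD S1 _] := subS.
  have [[eab ei]|/(off _ _ _ f')->] := pselect (a = b /\ i = 0); last first.
    by rewrite linear0.
  subst b i; have [u _ uK] := unit_bij a; rewrite -(uK f').
  rewrite linearZ /= grf_id.
  by have := SD a a 0 (u f') _ 0 (S1 a) (S0 a a 0); rewrite addr0.
apply: (freely_generated_ind (S := fun a b i f => S a b i (I n.+1 a b i f))
  (@free n) (subcategory_preim (I n.+1) subS)).
  by move=> a' b' i' h; rewrite IJ; exact: IHn.
by move=> g; exact: (Sx (existT _ n g)).
Qed.

Section Colimit.
Variables (D : grcat k Ob) (y : forall g : tower_fam, D (gsrc g) (gtgt g) (gdeg g)).

Lemma tower_compat : exists Phi : forall n, grfunctor (E n) D,
  (forall n a b i (f : E n a b i), Phi n.+1 a b i (J n a b i f) = Phi n a b i f) /\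
  (forall n (g : G n), Phi n.+1 _ _ _ (x g) = y (existT _ n g)).
Proof.
have [Phi0] := discrete_functor D E0.
have step n (Phi : grfunctor (E n) D) : {Psi : grfunctor (E n.+1) D |
    (forall a b i (f : E n a b i), Psi a b i (J n a b i f) = Phi a b i f) /\
    (forall g : G n, Psi _ _ _ (x g) = y (existT _ n g))}.
  by apply: cid; have [] := free Phi (fun g => y (existT _ n g)).
pose Phi := nat_rect (fun n => grfunctor (E n) D) Phi0
  (fun n Psi => sval (step n Psi)).
by exists Phi; split=> n *; [have [->] := svalP (step n (Phi n)) |
  have [_ ->] := svalP (step n (Phi n))].
Qed.

(** The value at a morphism of C is computed at any stage that contains it; since
the stages embed into C and the functors on them are compatible, the stage does not
matter. *)
Lemma tower_functor : exists Psi : grfunctor C D, forall g, Psi _ _ _ (tower_gen g) = y g.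
Proof.
have [Phi [PhiJ Phix]] := tower_compat.
have lift m n a b i (f : E m a b i) : (m <= n)%N ->
    exists f' : E n a b i, I n a b i f' = I m a b i f /\ Phi n a b i f' = Phi m a b i f.
  elim: n => [|n IHn]; first by rewrite leqn0 => /eqP e; subst m; exists f.
  rewrite leq_eqVlt => /orP[/eqP e|mn]; first by subst m; exists f.
  have [f' [<- <-]] := IHn mn.
  by exists (J n _ _ _ f'); rewrite IJ PhiJ.
have lift_eq m n a b i (f : E m a b i) (f' : E n a b i) :
    I m a b i f = I n a b i f' -> Phi m a b i f = Phi n a b i f'.
  have [u [Iu <-]] := lift m _ a b i f (leq_maxl m n).
  have [v [Iv <-]] := lift n _ a b i f' (leq_maxr m n).
  by rewrite -Iu -Iv => /I_inj->.
have value a b i (f : C a b i) : exists v : D a b i,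
    forall n (f' : E n a b i), I n a b i f' = f -> Phi n a b i f' = v.
  have [n [f' If']] := I_surj f; exists (Phi n a b i f') => n' f'' If''.
  by apply: lift_eq; rewrite If'.
pose m a b i (f : C a b i) : D a b i := sval (cid (value a b i f)).
have mE n a b i (f : E n a b i) : m a b i (I n a b i f) = Phi n a b i f.
  by rewrite /m; case: cid => v /= vE; rewrite (vE n f).
have two a b c d i j (f : C a b i) (g : C c d j) : exists n (f' : E n a b i)
    (g' : E n c d j), I n a b i f' = f /\ I n c d j g' = g.
  have [p [f' If']] := I_surj f; have [q [g' Ig']] := I_surj g.
  have [u [Iu _]] := lift p _ a b i f' (leq_maxl p q).
  have [v [Iv _]] := lift q _ c d j g' (leq_maxr p q).
  by exists (maxn p q), u, v; rewrite Iu Iv.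
have m_linear a b i : linear (m a b i).
  move=> c f g; have [n [f' [g' [<- <-]]]] := two _ _ _ _ _ _ f g.
  by rewrite -linearP !mE linearP.
pose M a b i : {linear C a b i -> D a b i} :=
  HB.pack (m a b i) (GRing.isLinear.Build _ _ _ _ _ (m_linear a b i)).
have Mid a : M a a 0 (grid C a) = grid D a.
  by rewrite /= -(grf_id (I 0)) mE grf_id.
have Mcomp a b c i j n (e : i + j = n) (g : C b c i) (f : C a b j) :
    M a c n (grcomp e g f) = grcomp e (M b c i g) (M a b j f).
  have [p [g' [f' [<- <-]]]] := two _ _ _ _ _ _ g f.
  by rewrite /= -(grf_comp (I p)) !mE grf_comp.
by exists (GrFunctor Mid Mcomp) => -[n g]; rewrite /= /tower_gen /= mE Phix.
Qed.

End Colimit.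

Lemma tower_free : free_on tower_gen.
Proof. split; [exact: tower_generates | exact: tower_functor]. Qed.

End Tower.

Lemma semi_free_free_on (k : comPzRingType) (Ob : Type) (C : dgcat k Ob) :
  semi_free C -> exists (G : genfam Ob) (x : forall g : G, C (gsrc g) (gtgt g) (gdeg g)),
    free_on x.
Proof.
move=> [E [J [I [E0 IJ I_inj I_surj gens]]]].
pose G n := sval (cid (gens n)); have Gx n := svalP (cid (gens n)).
pose x n := sval (cid (Gx n)); have free n := (svalP (cid (Gx n))).1.
by exists (tower_fam G), (tower_gen I x); exact: (tower_free E0 IJ I_inj I_surj free).
Qed.

Definition nonpos_fam (Ob : Type) (G : genfam Ob) : genfam Ob :=
  @GenFam Ob {g : G | gdeg g <= 0} (fun g => gsrc (sval g))
    (fun g => gtgt (sval g)) (fun g => gdeg (sval g)).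

(** A letter of positive degree is zero in C, hence can be left out of a free
generating family. *)
Lemma free_on_nonpos (k : comPzRingType) (Ob : Type) (C : grcat k Ob) (G : genfam Ob)
    (x : forall g : G, C (gsrc g) (gtgt g) (gdeg g)) :
  (forall a b, nonpositively_graded C a b) -> free_on x ->
  free_on (fun g : nonpos_fam G => x (sval g)).
Proof.
move=> C0 [gen ext]; split=> [S subS Sx|D y].
  apply: gen => // g; have [g0|g0] := leP (gdeg g) 0.
    exact: (Sx (exist _ g g0)).
  by rewrite [x g]C0 //; case: subS.
pose y' g : D (gsrc g) (gtgt g) (gdeg g) :=
  match pselect (gdeg g <= 0) with
  | left h => y (exist _ g h) | right _ => 0 end.
have [Psi Psix] := ext D y'.
exists Psi => -[g g0] /=; rewrite Psix /y'; case: pselect => // h.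
by rewrite (Prop_irrelevance h g0).
Qed.

Definition sum_fam (Ob : Type) (G G' : genfam Ob) : genfam Ob :=
  @GenFam Ob (G + G')%type
    (fun s => match s with inl g => gsrc g | inr g => gsrc g end)
    (fun s => match s with inl g => gtgt g | inr g => gtgt g end)
    (fun s => match s with inl g => gdeg g | inr g => gdeg g end).

Section FreeExtension.
Variables (k : comPzRingType) (Ob : Type) (B C : grcat k Ob) (F : grfunctor B C).
Variables (G G' : genfam Ob) (x : forall g : G, B (gsrc g) (gtgt g) (gdeg g)).
Variable y : forall g : G', C (gsrc g) (gtgt g) (gdeg g).

Definition sum_gen (s : sum_fam G G') : C (gsrc s) (gtgt s) (gdeg s) :=
  match s with inl g => F _ _ _ (x g) | inr g => y g end.

Lemma free_on_extension : free_on x -> freely_generated F y -> free_on sum_gen.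
Proof.
move=> [gen ext] free; split=> [S subS Sx|D z].
  apply: (freely_generated_ind free subS) => [a b i f|g]; last exact: (Sx (inr g)).
  apply: (gen (fun a b i f => S a b i (F a b i f)) (subcategory_preim F subS)) => g.
  exact: (Sx (inl g)).
have [Phi Phix] := ext D (fun g => z (inl g)).
have [[Psi [PsiF Psiy]] _] := free D Phi (fun g => z (inr g)).
by exists Psi => -[g|g] /=; rewrite ?PsiF ?Phix ?Psiy.
Qed.

End FreeExtension.
Lemma existT_inj (T : Type) (P : T -> Type) a (u v : P a) :
  existT P a u = existT P a v -> u = v.
Proof.
move=> e; have := projT2_eq e.
by rewrite (Prop_irrelevance (projT1_eq e) erefl).
Qed.

(** * Words and their values *)

Section Words.
Variables (k : comPzRingType) (Ob : Type) (H : grcat k Ob) (G : genfam Ob).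
Variable x : forall g : G, H (gsrc g) (gtgt g) (gdeg g).

(** A word is read in the order of composition: its last letter is applied first.
Words are arbitrary sequences of letters, and only those whose letters can be
composed have a value. *)
Inductive word_value : forall a b i, seq G -> H a b i -> Prop :=
| WordNil a : word_value [::] (grid H a)
| WordCons a j n g w (e : gdeg g + j = n) (f : H a (gsrc g) j) :
    word_value w f -> word_value (g :: w) (grcomp e (x g) f).

Inductive word_span a b i : H a b i -> Prop :=
| WordSpan0 : word_span 0
| WordSpanD l w (f g : H a b i) :
    word_value w f -> word_span g -> word_span (l *: f + g).

(** Source and degree are packed with the morphism because two values of a word with
a common target must be compared before their sources are known to agree. *)
Definition tag_source b a i (f : H a b i) : {a : Ob & {i : int & H a b i}} :=
  existT _ a (existT _ i f).

Lemma word_value_inv a b i w (f : H a b i) : word_value w f ->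
  match w with
  | [::] => exists e : b = a,
      tag_source f = eq_rect b (fun a => {a' : Ob & {i : int & H a' b i}})
        (tag_source (grid H b)) a e
  | g :: w' => exists (e : gtgt g = b) j (e' : gdeg g + j = i) (f' : H a (gsrc g) j),
      word_value w' f' /\
      f = eq_rect (gtgt g) (fun b => H a b i) (grcomp e' (x g) f') b e
  end.
Proof.
case=> [a'|a' j n g w' e f' wf]; first by exists erefl.
by exists erefl, j, e, f'.
Qed.

(** With the target given, the first letter can only be composed in one way, and its
source is the target of the rest of the word. *)
Lemma word_value_unique_tag a a' b i i' w (f : H a b i) (f' : H a' b i') :
  word_value w f -> word_value w f' -> tag_source f = tag_source f'.
Proof.
elim: w => [|g w IHw] in a a' b i i' f f' *.
  move=> /word_value_inv[e ->] /word_value_inv[e' ->].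
  by destruct e; destruct e'.
move=> /word_value_inv[e [j [ej [h [wh ->]]]]].
move=> /word_value_inv[e' [j' [ej' [h' [wh' ->]]]]].
have /= hh := IHw _ _ _ _ _ _ _ wh wh'.
subst b; rewrite (Prop_irrelevance e' erefl) /= {e'}.
(* Composition with the letter g as a function of the packed morphism, so that it can
   be applied to the equation between packed values. *)
pose z (t : {a : Ob & {i : int & H a (gsrc g) i}}) : {a : Ob & {i : int & H a (gtgt g) i}} :=
  tag_source (grcomp (erefl : gdeg g + projT1 (projT2 t) = _) (x g) (projT2 (projT2 t))).
have zE a0 j0 i0 (e0 : gdeg g + j0 = i0) (h0 : H a0 (gsrc g) j0) :
  tag_source (grcomp e0 (x g) h0) = z (tag_source h0) by destruct e0.
by rewrite !zE hh.
Qed.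

Lemma tag_source_inj a b i (f f' : H a b i) : tag_source f = tag_source f' -> f = f'.
Proof. by move=> e; exact: existT_inj (existT_inj e). Qed.

Lemma word_value_unique a b i w (f f' : H a b i) :
  word_value w f -> word_value w f' -> f = f'.
Proof. by move=> wf wf'; apply: tag_source_inj; exact: word_value_unique_tag wf wf'. Qed.

Lemma word_value_cat a b c i j n (e : i + j = n) u v (g : H b c i) (f : H a b j) :
  word_value u g -> word_value v f -> word_value (u ++ v) (grcomp e g f).
Proof.
move=> wg wf; elim: wg => {b c i u g} [b|b i l g u ei g' wg IHg] in j n e f wf *.
  have ej : n = j by rewrite -e add0r.
  by move: e; rewrite ej => e; rewrite grcomp1l.
have e1 : i + j = i + j by [].
have e2 : gdeg g + (i + j) = n by rewrite addrA ei.
by rewrite -(grcompA ei e1 e2 e); apply/WordCons/IHg.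
Qed.

Lemma word_spanP l a b i (f g : H a b i) :
  word_span f -> word_span g -> word_span (l *: f + g).
Proof.
move=> sf; elim: sf => {f} [|l' w f f' wf _ IHf] in l g * => sg.
  by rewrite scaler0 add0r.
by rewrite scalerDr -addrA scalerA; apply: (WordSpanD _ wf); exact: IHf.
Qed.

Lemma word_span_value a b i w (f : H a b i) : word_value w f -> word_span f.
Proof. by move=> wf; rewrite -[f]addr0 -[f]scale1r; exact/(WordSpanD _ wf)/WordSpan0. Qed.

Lemma word_span_mulw a b c i j n (e : i + j = n) u (g : H b c i) (f : H a b j) :
  word_value u g -> word_span f -> word_span (grcomp e g f).
Proof.
move=> wg; elim=> {f} [|l v f f' wf _ IHf].
  by rewrite grcomp0r; exact: WordSpan0.
rewrite grcompDr grcompZr; apply: WordSpanD; last exact: IHf.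
exact: word_value_cat wg wf.
Qed.

(** Concatenation of words makes their spans stable under composition. *)
Lemma word_span_subcategory : subcategory word_span.
Proof.
split=> [a b i|a b i l f g|a|a b c i j n e g f sg sf].
- exact: WordSpan0.
- exact: word_spanP.
- exact/word_span_value/WordNil.
elim: sg => {g} [|l u g g' wg _ IHg].
  by rewrite grcomp0l; exact: WordSpan0.
rewrite grcompDl grcompZl; apply: word_spanP; last exact: IHg.
exact: word_span_mulw wg sf.
Qed.

Lemma generates_word_span : generates x -> forall a b i (f : H a b i), word_span f.
Proof.
move=> gen a b i f; apply: gen => [|g]; first exact: word_span_subcategory.
apply: (@word_span_value _ _ _ [:: g]).
have -> : x g = grcomp (addr0 _) (x g) (grid H (gsrc g)) by rewrite grcomp1r.
exact/WordCons/WordNil.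
Qed.

End Words.

(** The graded category of linear operators on the functions from words to [M]; its
Hom-modules do not depend on the objects and degrees.  A letter acts by
f |-> (u |-> f (rcons u g)), so that a word w translates the argument by w on the
right.  Distinct words are separated by their action on functions, which is where
linear independence of words comes from. *)
Section RightTranslation.
Variables (k : comPzRingType) (Ob : Type) (G : genfam Ob) (M : lmodType k).

Definition word_fun : lmodType k := seq G -> M.

Definition linear_op : {pred word_fun -> word_fun} := fun T => `[< linear T >].
Fact linear_op_submod : submod_closed linear_op.
Proof.
split=> [|c T T' /asboolP Tlin /asboolP T'lin]; apply/asboolP=> l f g.
  by rewrite scaler0 addr0.
have E h : (c *: T + T') h = c *: T h + T' h by [].
by rewrite !E Tlin T'lin !scalerDr !scalerA [c * l]mulrC addrACA.
Qed.
HB.instance Definition _ :=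
  GRing.isSubmodClosed.Build k (word_fun -> word_fun) linear_op linear_op_submod.

Definition op_hom (a b : Ob) (i : int) : lmodType k := submod linear_op.

Lemma op_linear a b i (T : op_hom a b i) : linear (submod_val T).
Proof. exact/asboolP/(submod_valP T). Qed.

Definition op_mk a b i (T : word_fun -> word_fun) (Tlin : linear T) : op_hom a b i :=
  SubMod (introT (asboolP _) Tlin : T \in linear_op).

Lemma op_valP a b i l (T T' : op_hom a b i) h u :
  submod_val (l *: T + T') h u = l *: submod_val T h u + submod_val T' h u.
Proof. by []. Qed.

Lemma op_val0 a b i h u : submod_val (0 : op_hom a b i) h u = 0.
Proof. by []. Qed.

Definition op_id a : op_hom a a 0 := @op_mk a a 0 id (fun _ _ _ => erefl).

Fact op_comp_linear a b c i j (T : op_hom b c i) (T' : op_hom a b j) :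
  linear (submod_val T \o submod_val T').
Proof. by move=> l f g; rewrite /= (op_linear T') (op_linear T). Qed.

Definition op_comp a b c i j n (e : i + j = n) (T : op_hom b c i) (T' : op_hom a b j) :
  op_hom a c n := op_mk a c n (op_comp_linear T T').

Definition op_cat : grcat k Ob.
Proof.
apply: (@GrCat k Ob op_hom op_id op_comp).
- by move=> *; exact: submod_inj.
- by move=> *; exact: submod_inj.
- by move=> *; exact: submod_inj.
- by move=> a b c i j n e f l g g'; exact: submod_inj.
- move=> a b c i j n e g l f f'; apply: submod_inj.
  by apply: funext => u; exact: op_linear.
Defined.

Definition append_op (g : G) : word_fun -> word_fun := fun f u => f (rcons u g).

Fact append_op_linear g : linear (append_op g). Proof. by []. Qed.

Definition append_gen (g : G) : op_cat (gsrc g) (gtgt g) (gdeg g) :=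
  op_mk _ _ _ (append_op_linear g).

Lemma word_value_op (H : grcat k Ob) (x : forall g : G, H (gsrc g) (gtgt g) (gdeg g))
    (Theta : grfunctor H op_cat) a b i w (f : H a b i) :
  (forall g, Theta _ _ _ (x g) = append_gen g) -> word_value x w f ->
  forall h u, submod_val (Theta a b i f) h u = h (u ++ w).
Proof.
move=> Tx; elim=> {a b i w f} [a|a j n g w e f _ IHf] h u.
  by rewrite grf_id cats0.
by rewrite grf_comp Tx /= /append_op IHf cat_rcons.
Qed.

End RightTranslation.

(** * The basis of words ending with a contraction *)

Section Strip.
Variables (L1 L2 : Type).

(** The word without its longest suffix of letters of the first kind. *)
Fixpoint strip (w : seq (L1 + L2)) : seq (L1 + L2) :=
  match w with
  | [::] => [::]
  | g :: w' => match strip w', g with [::], inl _ => [::] | _, _ => g :: strip w' end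
  end.

Lemma strip_inl v : strip (map inl v) = [::].
Proof. by elim: v => //= g v ->. Qed.

Lemma strip_cat u v : strip (u ++ map inl v) = strip u.
Proof. by elim: u => [|g u /= ->] //; exact: strip_inl. Qed.

Lemma stripS g w : strip (g :: w) =
  match strip w, g with [::], inl _ => [::] | _, _ => g :: strip w end.
Proof. by []. Qed.

Lemma strip_cons g w : strip (g :: w) = g :: w ->
  if w is [::] then exists h, g = inr h else strip w = w.
Proof.
case: w => [|g' w]; first by case: g => //= h _; exists h.
rewrite stripS; case: (strip (g' :: w)) => [|h u]; first by case: g => // g [].
by case: g => g [-> ->].
Qed.

End Strip.

Definition osrc (Ob I : Type) (src : I -> Ob) (b : Ob) (p : option I) : Ob :=
  if p is Some t then src t else b.
Definition odeg (I : Type) (deg : I -> int) (p : option I) : int :=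
  if p is Some t then deg t else 0.
Definition oval (k : comPzRingType) (Ob : Type) (C : grcat k Ob) (b : Ob) (I : Type)
    (src : I -> Ob) (deg : I -> int) (el : forall t, C (src t) b (deg t))
    (p : option I) : C (osrc src b p) b (odeg deg p) :=
  match p as p return C (osrc src b p) b (odeg deg p) with
  | Some t => el t | None => grid C b end.

(** A basis of the right graded B-module C(-, b): one element of degree 0 at b, the
identity, encoded by [None], and elements of negative degree at objects of [X].
A coordinate is given in every degree [j], which avoids transport; it is meaningful
when [j] is the degree of the coefficient. *)
Record right_basis (k : comPzRingType) (Ob : Type) (B C : grcat k Ob)
    (F : grfunctor B C) (X : Ob -> Prop) (b : Ob) := RightBasis {
  rb_tail : choiceType;
  rb_tsrc : rb_tail -> Ob;
  rb_tdeg : rb_tail -> int;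
  rb_tval : forall t, C (rb_tsrc t) b (rb_tdeg t);
  rb_tsrcX : forall t, X (rb_tsrc t);
  rb_tdeg_lt0 : forall t, rb_tdeg t < 0;
  rb_coord : forall a (p : option rb_tail) j i,
    {linear C a b i -> B a (osrc rb_tsrc b p) j};
  rb_coord_same : forall a p j i (e : odeg rb_tdeg p + j = i) (c : B a _ j),
    rb_coord a p j i (grcomp e (oval rb_tval p) (F _ _ _ c)) = c;
  rb_coord_diff : forall a p p' j d i (e : odeg rb_tdeg p' + d = i) (c : B a _ d),
    p' <> p -> rb_coord a p j i (grcomp e (oval rb_tval p') (F _ _ _ c)) = 0;
  rb_ind : forall a i (P : C a b i -> Prop), P 0 ->
    (forall l q q', P q -> P q' -> P (l *: q + q')) ->
    (forall p j (e : odeg rb_tdeg p + j = i) (c : B a _ j),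
       P (grcomp e (oval rb_tval p) (F _ _ _ c))) ->
    forall q, P q
}.

(** Here C is freely generated over B by contracting endomorphisms [eps], and B is
itself free on letters of degree <= 0, so that C is free on both kinds of
letters. *)
Section Basis.
Variables (k : comPzRingType) (Ob : Type) (B C : grcat k Ob) (F : grfunctor B C).
Variables (G : genfam Ob) (x : forall g : G, B (gsrc g) (gtgt g) (gdeg g)).
Variable X : Ob -> Prop.
Variable eps : forall y : {y : Ob | X y}, C (sval y) (sval y) (-1).
Hypothesis deg_le0 : forall g : G, gdeg g <= 0.
Hypothesis x_free : free_on x.
Hypothesis eps_free : freely_generated F (G := contracting_fam X) eps.

Let letters := sum_fam G (contracting_fam X).
Let letter_val (s : letters) : C (gsrc s) (gtgt s) (gdeg s) :=
  @sum_gen k Ob B C F G (contracting_fam X) x eps s.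

Let letters_free : free_on letter_val := free_on_extension x_free eps_free.

Lemma word_value_inl a b i v (c : B a b i) :
  word_value x v c -> word_value letter_val (map inl v) (F a b i c).
Proof.
elim=> {a b i v c} [a|a j n g v e c _ IHc] /=.
  by rewrite grf_id; exact: WordNil.
by rewrite grf_comp; exact: (@WordCons _ _ _ _ letter_val a j n (inl g) _ e _ IHc).
Qed.

(** Cutting a word after its last letter [eps] writes its value as the value of a
word that is empty or ends with [eps], composed with a morphism of B. *)
Lemma word_value_split a b n w (q : C a b n) : word_value letter_val w q ->
  exists (c : Ob) (d j : int) (e : d + j = n) (u : seq letters) (v : seq G)
    (r : C c b d) (h : B a c j),
  [/\ word_value letter_val u r, word_value x v h, strip u = u,
      w = u ++ map inl v & q = grcomp e r (F _ _ _ h)].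
Proof.
elim=> {a b n w q} [a|a j n g w e q wq [c [d [l [e' [u [v [r [h]]]]]]]]].
  exists a, 0, 0, (addr0 0), [::], [::], (grid C a), (grid B a).
  by split; rewrite ?grf_id ?grcomp1l //; constructor.
move=> [wr wh su -> ->] {w q wq}.
have e1 : gdeg g + d + l = n by rewrite -addrA e'.
have -> : grcomp e (letter_val g) (grcomp e' r (F a c l h)) =
    grcomp e1 (grcomp erefl (letter_val g) r) (F a c l h) by exact: grcompA.
have stay : strip (g :: u) = g :: u ->
  exists (c0 : Ob) (d0 j0 : int) (e0 : d0 + j0 = n) (u0 : seq letters)
    (v0 : seq G) (r0 : C c0 (gtgt g) d0) (h0 : B a c0 j0),
  [/\ word_value letter_val u0 r0, word_value x v0 h0, strip u0 = u0,
      g :: u ++ map inl v = u0 ++ map inl v0 &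
      grcomp e1 (grcomp erefl (letter_val g) r) (F a c l h) = grcomp e0 r0 (F _ _ _ h0)].
  move=> sgu; exists c, (gdeg g + d), l, e1, (g :: u), v, (grcomp erefl (letter_val g) r), h.
  by split=> //; exact: WordCons.
case: u su wr stay => [|g' u] su wr stay; last first.
  by by apply: stay; rewrite stripS su; case: (g).
case: g e e1 r wr stay => g e e1 r wr stay; last exact: stay.
have [ec rE] := word_value_inv wr; clear wr.
subst c; have {}rE := existT_inj rE.
have d0 : d = 0 := projT1_eq rE; subst d; have {}rE := existT_inj rE.
subst r; exists (gtgt g), 0, n, (add0r n), [::], (g :: v), (grid C (gtgt g)).
have e2 : gdeg g + l = n by rewrite -e1 addr0.
exists (grcomp e2 (x g) h); split=> //; try by constructor.
by rewrite -(grcompA erefl (add0r l) e2 e1) !grcomp1l grf_comp.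
Qed.

(** The nonempty basis words.  The value is stored although the word determines it,
so that the basis elements have the expected types without transport. *)
Record tail_idx (b : Ob) := TailIdx {
  tail_word : seq letters;
  tail_src : Ob;
  tail_deg : int;
  tail_val : C tail_src b tail_deg;
  tail_value : word_value letter_val tail_word tail_val;
  tail_strip : strip tail_word = tail_word;
  tail_neq : tail_word <> [::]
}.

Lemma tail_idx_inj b (p p' : tail_idx b) : tail_word p = tail_word p' -> p = p'.
Proof.
case: p p' => [w a i q wq sw w0] [w' a' i' q' wq' sw' w0'] /= ww'; subst w'.
have tt := word_value_unique_tag wq wq'.
have aa : a = a' := projT1_eq tt; subst a'; have {}tt := existT_inj tt.
have ii : i = i' := projT1_eq tt; subst i'; have {}tt := existT_inj tt.
subst q'.
by rewrite (Prop_irrelevance wq wq') (Prop_irrelevance sw sw') (Prop_irrelevance w0 w0').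
Qed.

Lemma letter_deg_le0 (g : letters) : gdeg g <= 0.
Proof. by case: g. Qed.

(** The last letter is some [eps], whose source is in [X] and whose degree is -1,
and no letter has positive degree. *)
Lemma tail_idxP b (p : tail_idx b) : X (tail_src p) /\ tail_deg p < 0.
Proof.
case: p => w a i q /=; elim: w => [|g w IHw] // in a b i q * => wq /strip_cons sw _.
have [e [j [e' [f' [wf' _]]]]] := word_value_inv wq; clear wq.
case: w sw IHw wf' => [[h gE] _|g' w sw IHw] wf'.
  have [ec rE] := word_value_inv wf'; subst a g.
  have ej : j = 0 := projT1_eq (existT_inj rE).
  by split; [exact: svalP h | rewrite -e' ej addr0].
have [//|//|Xa ltj] := IHw _ _ _ _ wf'.
split=> //; rewrite -e'.
by rewrite -[0]addr0 ler_ltD // letter_deg_le0.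
Qed.

Section Coordinates.
Variable b : Ob.
Implicit Types p : option (tail_idx b).

Let bsrc := osrc (@tail_src b) b.
Let bdeg := odeg (@tail_deg b).
Let bel := oval (@tail_val b).
Definition bword p : seq letters := if p is Some t then tail_word t else [::].

Lemma bword_value p : word_value letter_val (bword p) (bel p).
Proof. by case: p => [t|]; [exact: tail_value | exact: WordNil]. Qed.

Lemma bword_strip p : strip (bword p) = bword p.
Proof. by case: p => [t|] //; exact: tail_strip. Qed.

Lemma bword_inj p p' : bword p = bword p' -> p = p'.
Proof.
case: p p' => [t|] [t'|] //=; first by move=> /tail_idx_inj->.
- by move=> /tail_neq.
- by move=> /esym/tail_neq.
Qed.

Section Coordinate.
Variables (a : Ob) (p : option (tail_idx b)) (j : int).

(** The coefficient of the basis word [p] is read off by evaluating an operator on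
this function at the empty word.  The operator of a word w evaluates it at w, where
it returns the value of v if w = p v with v a word of B, and 0 otherwise.  Taking a
Hom-module of B as the module of values makes the coordinate a morphism of B. *)
Definition word_coord_test : word_fun letters (B a (bsrc p) j) := fun w =>
  match pselect (exists (c : B a (bsrc p) j) (v : seq G),
                   w = (bword p ++ map inl v)%SEQ /\ word_value x v c) with
  | left h => sval (cid h)
  | right _ => 0
  end.

Lemma word_coord_testE (v : seq G) (c : B a (bsrc p) j) :
  word_value x v c -> word_coord_test (bword p ++ map inl v)%SEQ = c.
Proof.
move=> vc; rewrite /word_coord_test; case: pselect => [h|[]]; last by exists c, v.
case: cid => c' /= [v' [/(f_equal (drop (size (bword p))))]].
rewrite !drop_size_cat // => vv' vc'; apply: word_value_unique vc' _.
suff -> : v' = v by [].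
elim: v v' vv' {vc h} => [|g v IHv] [|g' v'] //= [-> /IHv->//].
Qed.

Lemma word_coord_test0 p' (v : seq G) :
  p' <> p -> word_coord_test (bword p' ++ map inl v)%SEQ = 0.
Proof.
move=> pp'; rewrite /word_coord_test; case: pselect => // h.
have [c [v' [ww _]]] := h; case: pp'.
by apply: bword_inj; have := f_equal (@strip _ _) ww; rewrite !strip_cat !bword_strip.
Qed.

Definition append_functor : {Theta : grfunctor C (op_cat letters (B a (bsrc p) j)) |
  forall g, Theta _ _ _ (letter_val g) = append_gen _ g}.
Proof. by apply: cid; case: letters_free => _; exact. Qed.

Definition word_coord_fun i (q : C a b i) : B a (bsrc p) j :=
  submod_val (sval append_functor a b i q) word_coord_test [::].

Fact word_coord_linear i : linear (@word_coord_fun i).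
Proof. by move=> l q q'; rewrite /word_coord_fun linearP. Qed.
HB.instance Definition _ i :=
  GRing.isLinear.Build k (C a b i) (B a (bsrc p) j) _ (@word_coord_fun i)
    (@word_coord_linear i).

Lemma word_coord_bel p' d i (e : bdeg p' + d = i) (c : B a (bsrc p') d) :
  word_coord_fun (grcomp e (bel p') (F _ _ _ c)) =
  submod_val (sval append_functor _ _ _ (F _ _ _ c)) word_coord_test (bword p').
Proof.
have Th := svalP append_functor.
by rewrite /word_coord_fun grf_comp /= (word_value_op Th (bword_value p')).
Qed.

End Coordinate.

Definition word_coord a p j i : {linear C a b i -> B a (bsrc p) j} :=
  @word_coord_fun a p j i.

Lemma word_coord_same a p j i (e : bdeg p + j = i) (c : B a (bsrc p) j) :
  word_coord a p j i (grcomp e (bel p) (F _ _ _ c)) = c.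
Proof.
rewrite [LHS]word_coord_bel; have Th := svalP (append_functor a p j).
elim: (generates_word_span x_free.1 c) => {c} [|l v c c' vc _ IHc].
  by rewrite !grf0 op_val0.
rewrite !grfP op_valP IHc.
by rewrite (word_value_op Th (word_value_inl vc)) (word_coord_testE vc).
Qed.

Lemma word_coord_diff a p p' j d i (e : bdeg p' + d = i) (c : B a (bsrc p') d) :
  p' <> p -> word_coord a p j i (grcomp e (bel p') (F _ _ _ c)) = 0.
Proof.
move=> pp'; rewrite [LHS]word_coord_bel; have Th := svalP (append_functor a p j).
elim: (generates_word_span x_free.1 c) => {c} [|l v c c' vc _ IHc].
  by rewrite !grf0 op_val0.
rewrite !grfP op_valP IHc.
by rewrite (word_value_op Th (word_value_inl vc)) word_coord_test0 // scaler0 addr0.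
Qed.

(** The basis words span over B because words span over k. *)
Lemma basis_ind a i (P : C a b i -> Prop) : P 0 ->
  (forall l q q', P q -> P q' -> P (l *: q + q')) ->
  (forall p j (e : bdeg p + j = i) (c : B a (bsrc p) j),
     P (grcomp e (bel p) (F _ _ _ c))) ->
  forall q, P q.
Proof.
move=> P0 PD Pb q; have [gen _] := letters_free.
elim: (generates_word_span gen q) => {q} [|l w q q' wq _ Pq'] //; apply: PD => //.
have [c [d [j [e [u [v [r [h [ur vh us wE ->]]]]]]]]] := word_value_split wq.
case: u us ur {wE} => [|g u] us ur.
  have [ec rE] := word_value_inv ur; subst c; have {}rE := existT_inj rE.
  have d0 : d = 0 := projT1_eq rE; subst d; have {}rE := existT_inj rE.
  by subst r; exact: (Pb None).
have gu0 : g :: u <> [::] by [].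
exact: (Pb (Some (TailIdx ur us gu0))).
Qed.

Definition right_basis_of : right_basis F X b :=
  @RightBasis k Ob B C F X b {classic tail_idx b} (@tail_src b) (@tail_deg b) (@tail_val b)
    (fun t => (tail_idxP t).1) (fun t => (tail_idxP t).2) word_coord
    (@word_coord_same) (@word_coord_diff) (@basis_ind).

End Coordinates.

End Basis.

(** * Coordinates in a right basis *)

Section RightBasis.
Variables (k : comPzRingType) (Ob : Type) (B C : grcat k Ob) (F : grfunctor B C).
Variables (X : Ob -> Prop) (b : Ob) (R : right_basis F X b).

Definition basis_idx : choiceType := option (rb_tail R).
Definition bsrc (p : basis_idx) : Ob := osrc (rb_tsrc (r:=R)) b p.
Definition bdeg (p : basis_idx) : int := odeg (rb_tdeg (r:=R)) p.
Definition bel (p : basis_idx) : C (bsrc p) b (bdeg p) := oval (rb_tval (r:=R)) p.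
Definition bcoord a (p : basis_idx) j i : {linear C a b i -> B a (bsrc p) j} :=
  @rb_coord _ _ _ _ _ _ _ R a p j i.

Lemma bcoord_same a p j i (e : bdeg p + j = i) (c : B a (bsrc p) j) :
  bcoord a p j i (grcomp e (bel p) (F _ _ _ c)) = c.
Proof. exact: rb_coord_same. Qed.

Lemma bcoord_diff a p p' j d i (e : bdeg p' + d = i) (c : B a (bsrc p') d) :
  p' <> p -> bcoord a p j i (grcomp e (bel p') (F _ _ _ c)) = 0.
Proof. exact: rb_coord_diff. Qed.

Lemma bdeg_le0 p : bdeg p <= 0.
Proof. by case: p => //= t; exact/ltW/rb_tdeg_lt0. Qed.

Lemma bcoord0 a p j i : bcoord a p j i 0 = 0. Proof. exact: linear0. Qed.
Lemma bcoordP a p j i l (q q' : C a b i) :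
  bcoord a p j i (l *: q + q') = l *: bcoord a p j i q + bcoord a p j i q'.
Proof. exact: linearP. Qed.
Lemma bcoordD a p j i (q q' : C a b i) :
  bcoord a p j i (q + q') = bcoord a p j i q + bcoord a p j i q'.
Proof. exact: linearD. Qed.
Lemma bcoordB a p j i (q q' : C a b i) :
  bcoord a p j i (q - q') = bcoord a p j i q - bcoord a p j i q'.
Proof. exact: linearB. Qed.
Lemma bcoordZ a p j i l (q : C a b i) :
  bcoord a p j i (l *: q) = l *: bcoord a p j i q.
Proof. exact: linearZ. Qed.
Lemma bcoord_sum (I : Type) (s : seq I) a p j i (q : I -> C a b i) :
  bcoord a p j i (\sum_(t <- s) q t) = \sum_(t <- s) bcoord a p j i (q t).
Proof. exact: linear_sum. Qed.

Lemma degK (d i : int) : d + (i - d) = i. Proof. by rewrite addrC subrK. Qed.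

Definition expansion a i (q : C a b i) (s : seq basis_idx) : C a b i :=
  \sum_(p <- s) grcomp (degK (bdeg p) i) (bel p) (F _ _ _ (bcoord a p (i - bdeg p) i q)).

(** The sequence [s] contains the support of the coordinates of [q]. *)
Definition expanded a i (q : C a b i) (s : seq basis_idx) : Prop :=
  (forall p j, p \notin s -> bcoord a p j i q = 0) /\ uniq s /\ q = expansion q s.

Lemma expansion_linear a i s l (q q' : C a b i) :
  expansion (l *: q + q') s = l *: expansion q s + expansion q' s.
Proof.
rewrite /expansion scaler_sumr -big_split; apply: eq_bigr => p _ /=.
by rewrite bcoordP grfP grcompDr grcompZr.
Qed.

Lemma expanded_sub a i (q : C a b i) s s' :
  expanded q s -> uniq s' -> {subset s <= s'} -> expanded q s'.
Proof.
move=> [q0 [us qs]] us' ss'; split=> [p j ps'|].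
  by apply: q0; apply: contra ps'; exact: ss'.
split=> //; rewrite {1}qs; apply: big_supp => // p ps.
  by rewrite q0 // grf0 grcomp0r.
rewrite q0 ?grf0 ?grcomp0r //; apply: contra ps; exact: ss'.
Qed.

Lemma expanded_bel a p j i (e : bdeg p + j = i) (c : B a (bsrc p) j) :
  expanded (grcomp e (bel p) (F _ _ _ c)) [:: p].
Proof.
split=> [p' j'|]; first by rewrite inE eq_sym => /eqP pp'; exact: bcoord_diff.
split=> //; rewrite /expansion big_seq1.
have ej : j = i - bdeg p by rewrite -e [_ + j]addrC addrK.
by subst j; rewrite bcoord_same; congr grcomp; exact: eq_irrelevance.
Qed.

Lemma expandedP a i (q : C a b i) : exists s, expanded q s.
Proof.
have [] // := rb_ind (r := R) (P := fun q => exists s, expanded q s) _ _ _ q.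
- exists [::]; split=> [p j _|]; first exact: bcoord0.
  by rewrite /expansion big_nil.
- move=> l q1 q' [s sq] [s' sq'].
  pose t := undup (s ++ s').
have qt : expanded q1 t.
  by apply: expanded_sub sq _ _ => [|p ps]; rewrite ?undup_uniq // mem_undup mem_cat ps.
have q't : expanded q' t.
  by apply: expanded_sub sq' _ _ => [|p ps]; rewrite ?undup_uniq // mem_undup mem_cat ps orbT.
exists t; split=> [p j pt|].
  by rewrite bcoordP qt.1 // q't.1 // scaler0 addr0.
split; first exact: undup_uniq.
by rewrite expansion_linear -qt.2.2 -q't.2.2.
- by move=> p j e c; exists [:: p]; exact: expanded_bel.
- by move=> s qs; exists s.
Qed.

(** The coordinates are right B-linear: the composite with [c] of the expansion of
[q] is an expansion of the composite. *)
Lemma bcoord_comp a a' p i j l n j' (e : i + l = n) (e' : j + l = j')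
    (ep : bdeg p + j = i) (q : C a b i) (c : B a' a l) :
  bcoord a' p j' n (grcomp e q (F _ _ _ c)) = grcomp e' (bcoord a p j i q) c.
Proof.
have ej : j = i - bdeg p by rewrite -ep [_ + j]addrC addrK.
subst j; have [s [q0 [us qE]]] := expandedP q.
have term p' : exists ep', grcomp e (grcomp (degK (bdeg p') i) (bel p')
    (F _ _ _ (bcoord a p' (i - bdeg p') i q))) (F _ _ _ c) =
    grcomp ep' (bel p') (F _ _ _ (grcomp (erefl (i - bdeg p' + l))
      (bcoord a p' (i - bdeg p') i q) c)).
  have ep' : bdeg p' + (i - bdeg p' + l) = n by rewrite addrA degK.
  by exists ep'; rewrite grf_comp; apply/esym; exact: grcompA.
rewrite {1}qE /expansion grcomp_suml bcoord_sum.
have other p' : p' <> p -> bcoord a' p j' n (grcomp e (grcomp (degK (bdeg p') i) (bel p')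
    (F _ _ _ (bcoord a p' (i - bdeg p') i q))) (F _ _ _ c)) = 0.
  by move=> pp'; have [ep' ->] := term p'; exact: bcoord_diff.
have [ps|ps] := boolP (p \in s); last first.
  rewrite q0 // grcomp0l big_seq big1 // => p' p's; apply: other => pp'.
  by move: ps; rewrite -pp' p's.
rewrite (bigD1_seq p) //= big1 ?addr0 => [|p' /eqP]; last exact: other.
have [ep' ->] := term p; subst j'; exact: bcoord_same.
Qed.

End RightBasis.

(** * The filtration by the degree of basis words *)

Section Differential.
Variables (k : comPzRingType) (Ob : Type) (C : dgcat k Ob).

Lemma dgd0 a b i j (e : i + 1 = j) : dgd C e (0 : C a b i) = 0.
Proof. exact: linear0. Qed.
Lemma dgdB a b i j (e : i + 1 = j) (f g : C a b i) :
  dgd C e (f - g) = dgd C e f - dgd C e g.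
Proof. exact: linearB. Qed.
Lemma dgdD a b i j (e : i + 1 = j) (f g : C a b i) :
  dgd C e (f + g) = dgd C e f + dgd C e g.
Proof. exact: linearD. Qed.
Lemma dgdZ a b i j (e : i + 1 = j) l (f : C a b i) :
  dgd C e (l *: f) = l *: dgd C e f.
Proof. exact: linearZ. Qed.
Lemma dgd_sum (I : Type) (s : seq I) a b i j (e : i + 1 = j) (f : I -> C a b i) :
  dgd C e (\sum_(t <- s) f t) = \sum_(t <- s) dgd C e (f t).
Proof. exact: linear_sum. Qed.

End Differential.

Section Contraction.
Variables (k : comPzRingType) (A : klincat k) (C : dgcat k A).
Variable pi : dgfunctor C (deg0 A).
Hypothesis pi_qis : quasi_isomorphism pi.
Hypothesis C_nonpos : forall a b, nonpositively_graded C a b.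

Definition pi0 a b : {linear C a b 0 -> A a b} := pi a b 0.

Lemma pi0_comp a b c (e : 0 + 0 = 0) (g : C b c 0) (f : C a b 0) :
  pi0 a c (grcomp e g f) = klcomp (pi0 b c g) (pi0 a b f).
Proof. by rewrite /pi0 grf_comp. Qed.

Lemma pi0_surj a b (f : A a b) : exists c, pi0 a b c = f.
Proof.
have [_ surj] := pi_qis a b (i := -1) (j := 0) (l := 1) erefl erefl.
by have [c [h [_ ->]]] := surj f erefl; exists c; rewrite /= addr0.
Qed.

Lemma pi_ne0 a b i (c : C a b i) : i != 0 -> pi a b i c = 0.
Proof. exact: deg0_eq0. Qed.

Lemma pi_d a b i j (e : i + 1 = j) (c : C a b i) : pi a b j (dgd C e c) = 0.
Proof. by rewrite dgf_d. Qed.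

Lemma pi_exact a b i j l (e : i + 1 = j) (e' : j + 1 = l) (c : C a b j) :
  dgd C e' c = 0 -> pi a b j c = 0 -> exists h, dgd C e h = c.
Proof.
move=> dc pc; have [inj _] := pi_qis a b e e'.
by apply: inj => //; exists 0; rewrite pc dgd0.
Qed.

Variables (Q : dgcat k A) (F : dgfunctor C Q) (X : A -> Prop) (b : A).
Variable R : right_basis F X b.

Lemma bcoord_pos a (p : basis_idx R) j i (q : Q a b i) : 0 < j -> bcoord a p j i q = 0.
Proof. by move=> j0; rewrite [LHS]C_nonpos. Qed.

Lemma Q_nonpos a : nonpositively_graded Q a b.
Proof.
move=> i q i0; have [s [_ [_ ->]]] := expandedP R q.
rewrite /expansion big1 // => p _.
rewrite bcoord_pos ?grf0 ?grcomp0r // subr_gt0.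
exact: le_lt_trans (bdeg_le0 p) i0.
Qed.

Lemma dgd_grcompF a a' i j n i' j' n' (e : i + j = n) (ei : i + 1 = i') (ej : j + 1 = j')
    (en : n + 1 = n') (e1 : i' + j = n') (e2 : i + j' = n') (q : Q a b i) (c : C a' a j) :
  dgd Q en (grcomp e q (F _ _ _ c)) = grcomp e1 (dgd Q ei q) (F _ _ _ c)
    + (-1) ^+ absz i *: grcomp e2 q (F _ _ _ (dgd C ej c)).
Proof. by rewrite (dg_leibniz e ei ej en e1 e2) -dgf_d. Qed.

(** If no basis word of degree less than [N] occurs in [q], then the coordinate of
d q at a word p of degree at most [N] only involves the coordinate of [q] at p.
Indeed d p' only has coordinates at basis words of degree larger than that of p',
because C is non-positive. *)
Lemma bcoord_d_lead a (i j l l' N : int) (e : i + 1 = j) (el : l + 1 = l') (p : basis_idx R)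
    (q : Q a b i) : bdeg p + l = i -> bdeg p <= N ->
  (forall (p' : basis_idx R) m, bdeg p' + m = i -> bdeg p' < N -> bcoord a p' m i q = 0) ->
  bcoord a p l' j (dgd Q e q) = (-1) ^+ absz (bdeg p) *: dgd C el (bcoord a p l i q).
Proof.
move=> epl pN qN; have [s [q0 [us qE]]] := expandedP R q.
pose t (p' : basis_idx R) :=
  grcomp (degK (bdeg p') i) (bel p') (F _ _ _ (bcoord a p' (i - bdeg p') i q)).
have eqE : q = \sum_(p' <- s) t p' by [].
have lE : l = i - bdeg p by rewrite -epl [_ + l]addrC addrK.
have ed (p' : basis_idx R) : i - bdeg p' + 1 = j - bdeg p' by rewrite addrAC e.
have tE p' : bcoord a p l' j (dgd Q e (t p')) = (-1) ^+ absz (bdeg p') *: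
    bcoord a p l' j (grcomp (degK (bdeg p') j) (bel p') (F _ _ _
      (dgd C (ed p') (bcoord a p' (i - bdeg p') i q)))).
  have [p'N|Np'] := ltP (bdeg p') N.
    by rewrite /t qN ?degK // dgd0 !grf0 !grcomp0r dgd0 !bcoord0 scaler0.
  have e1 : bdeg p' + 1 + (i - bdeg p') = j by rewrite addrAC degK.
  rewrite /t (dgd_grcompF _ erefl (ed p') _ e1 (degK _ _)) bcoordD bcoordZ.
  have em : bdeg p + (bdeg p' + 1 - bdeg p) = bdeg p' + 1 by rewrite degK.
  have em' : bdeg p' + 1 - bdeg p + (i - bdeg p') = l'.
    by rewrite -el lE; lia.
  rewrite (bcoord_comp _ em' em) bcoord_pos ?grcomp0l ?add0r //.
  by rewrite subr_gt0 (le_lt_trans (le_trans pN Np')) // ltrDl.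
have same : bcoord a p l' j (dgd Q e (t p)) =
    (-1) ^+ absz (bdeg p) *: dgd C el (bcoord a p l i q).
  rewrite tE; congr (_ *: _); subst l.
  have l'E : l' = j - bdeg p by rewrite -el ed.
  move: el; rewrite l'E => el; rewrite bcoord_same.
  by congr (dgd C _ _); exact: eq_irrelevance.
have diff (p' : basis_idx R) : p' <> p -> bcoord a p l' j (dgd Q e (t p')) = 0.
  by move=> pp'; rewrite tE bcoord_diff ?scaler0.
rewrite {1}eqE dgd_sum bcoord_sum.
have [ps|ps] := boolP (p \in s).
  by rewrite (bigD1_seq p) //= same big1 ?addr0 // => p' /eqP; exact: diff.
rewrite q0 // dgd0 scaler0 big_seq big1 // => p' p's; apply: diff => pp'.
by move: ps; rewrite -pp' p's.
Qed.

(** The submodule Q(-, b) . ker pi of Q(-, b), described by coordinates. *)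
Definition coord_ker a i : {pred Q a b i} := fun q =>
  `[< forall (p : basis_idx R) j, bdeg p + j = i -> pi _ _ _ (bcoord a p j i q) = 0 >].

Fact coord_ker_submod a i : submod_closed (@coord_ker a i).
Proof.
split=> [|l q q' /asboolP kq /asboolP kq']; apply/asboolP=> p j e.
  by rewrite bcoord0 grf0.
by rewrite bcoordP grfP kq // kq' // scaler0 addr0.
Qed.
HB.instance Definition _ a i :=
  GRing.isSubmodClosed.Build k (Q a b i) (@coord_ker a i) (@coord_ker_submod a i).

Lemma coord_ker_comp a a' i j n (e : i + j = n) (q : Q a b i) (c : C a' a j) :
  q \in @coord_ker a i -> grcomp e q (F _ _ _ c) \in @coord_ker a' n.
Proof.
move=> /asboolP kq; apply/asboolP => p l el.
have em : bdeg p + (i - bdeg p) = i := degK _ _.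
have em' : i - bdeg p + j = l by rewrite addrAC e -el [_ + l]addrC addrK.
by rewrite (bcoord_comp _ em' em) grf_comp kq // grcomp0l.
Qed.

Lemma coord_ker_compr a a' i j n (e : i + j = n) (q : Q a b i) (c : C a' a j) :
  pi _ _ _ c = 0 -> grcomp e q (F _ _ _ c) \in @coord_ker a' n.
Proof.
move=> pc; apply/asboolP => p l el.
have em : bdeg p + (i - bdeg p) = i := degK _ _.
have em' : i - bdeg p + j = l by rewrite addrAC e -el [_ + l]addrC addrK.
by rewrite (bcoord_comp _ em' em) grf_comp pc // grcomp0r.
Qed.

Lemma coord_ker_d a i j (e : i + 1 = j) (q : Q a b i) :
  q \in @coord_ker a i -> dgd Q e q \in @coord_ker a j.
Proof.
move=> /asboolP kq; have [s [_ [_ ->]]] := expandedP R q.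
rewrite /expansion dgd_sum; apply: rpred_sum => p _.
have ed : i - bdeg p + 1 = j - bdeg p by rewrite addrAC e.
have e1 : bdeg p + 1 + (i - bdeg p) = j by rewrite addrAC degK.
rewrite (dgd_grcompF _ erefl ed _ e1 (degK _ _)).
apply: rpredD; [|apply: rpredZ]; apply: coord_ker_compr; last exact: pi_d.
by apply: kq; exact: degK.
Qed.

(** The coordinates of a cocycle [q] at the words of lowest degree [N] are cocycles
of C by [bcoord_d_lead].  If they are killed by pi they are coboundaries, and their
primitives are the coordinates of an element whose differential cancels them. *)
Lemma coord_ker_exact_step a (i j j' N : int) (e : i + 1 = j) (e' : j + 1 = j')
    (q : Q a b j) : q \in @coord_ker a j -> dgd Q e' q = 0 ->
  (forall (p : basis_idx R) m, bdeg p + m = j -> bdeg p < N -> bcoord a p m j q = 0) ->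
  exists q1, q1 \in @coord_ker a i /\
    forall (p : basis_idx R) m, bdeg p + m = j -> bdeg p <= N ->
      bcoord a p m j (q - dgd Q e q1) = 0.
Proof.
move=> kq dq qN; have [s [q0 [us qE]]] := expandedP R q.
have ed (p : basis_idx R) : i - bdeg p + 1 = j - bdeg p by rewrite addrAC e.
(* Where j - bdeg p is positive the coordinate is zero, and so must be the primitive,
   which could otherwise have degree 0 and be seen by pi. *)
have lift (p : basis_idx R) : exists h : C a (bsrc p) (i - bdeg p),
    [/\ pi _ _ _ h = 0, bdeg p != N -> h = 0 &
        bdeg p = N -> dgd C (ed p) h = bcoord a p (j - bdeg p) j q].
  have [pN|pN] := eqVneq (bdeg p) N; last first.
    by exists 0; rewrite grf0; split=> // /eqP; rewrite (negPf pN).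
  have [jp|jp] := ltP 0 (j - bdeg p).
    by exists 0; rewrite grf0 dgd0 bcoord_pos //; split.
  have ed' : j - bdeg p + 1 = j' - bdeg p by rewrite addrAC e'.
  have dc : dgd C ed' (bcoord a p (j - bdeg p) j q) = 0.
    apply: (can_inj (signrZK (absz (bdeg p)))).
    rewrite -(bcoord_d_lead e' ed' (degK _ _) _ qN); last by rewrite pN.
    by rewrite dq bcoord0 scaler0.
  have pc : pi _ _ _ (bcoord a p (j - bdeg p) j q) = 0.
    by move/asboolP: kq; apply; exact: degK.
  have [h dh] := pi_exact (ed p) dc pc.
  exists h; split=> //; apply: pi_ne0.
  by apply: contraTneq jp => h0; rewrite -ed h0 add0r -ltNge.
have [h hP] : exists h : forall p : basis_idx R, C a (bsrc p) (i - bdeg p),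
    forall p, [/\ pi _ _ _ (h p) = 0, bdeg p != N -> h p = 0 &
      bdeg p = N -> dgd C (ed p) (h p) = bcoord a p (j - bdeg p) j q].
  by exists (fun p => sval (cid (lift p))) => p; exact: (svalP (cid (lift p))).
exists (\sum_(p <- s) (-1) ^+ absz (bdeg p) *:
  grcomp (degK (bdeg p) i) (bel p) (F _ _ _ (h p))).
set q1 := \sum_(p <- s) _.
split.
  apply: rpred_sum => p _; apply: rpredZ; apply: coord_ker_compr.
  by case: (hP p).
have q1c p : bcoord a p (i - bdeg p) i q1 =
    if p \in s then (-1) ^+ absz (bdeg p) *: h p else 0.
  rewrite bcoord_sum; case: ifP => [ps|/negP ps].
    rewrite (bigD1_seq p) //= big1 ?addr0 => [|p' /eqP pp'].
      by rewrite bcoordZ bcoord_same.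
    by rewrite bcoordZ bcoord_diff ?scaler0.
  rewrite big_seq big1 // => p' p's; rewrite bcoordZ bcoord_diff ?scaler0 // => pp'.
  by rewrite -pp' p's in ps.
have q1N (p : basis_idx R) m : bdeg p + m = i -> bdeg p < N -> bcoord a p m i q1 = 0.
  move=> em pN; have mE : m = i - bdeg p by rewrite -em [_ + m]addrC addrK.
  subst m; rewrite q1c; case: ifP => // _; have [_ h0 _] := hP p.
  by rewrite h0 ?scaler0 // lt_eqF.
move=> p m em pN; have mE : m = j - bdeg p by rewrite -em [_ + m]addrC addrK.
subst m; rewrite bcoordB (bcoord_d_lead e (ed p) (degK _ _) pN q1N) q1c.
have [ps|ps] := boolP (p \in s); last by rewrite q0 // dgd0 scaler0 subr0.
rewrite dgdZ signrZK; have [_ h0 hN] := hP p.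
have [pN'|pN'] := eqVneq (bdeg p) N; first by rewrite hN // subrr.
by rewrite h0 // dgd0 subr0 qN // lt_neqAle pN'.
Qed.

(** The lowest degree occurring in [q] is raised step by step; no basis word has
positive degree. *)
Lemma coord_ker_exact a i j j' (e : i + 1 = j) (e' : j + 1 = j') (q : Q a b j) :
  q \in @coord_ker a j -> dgd Q e' q = 0 ->
  exists q', q' \in @coord_ker a i /\ dgd Q e q' = q.
Proof.
have main m : forall q : Q a b j, q \in @coord_ker a j -> dgd Q e' q = 0 ->
    (forall (p : basis_idx R) l, bdeg p + l = j -> bdeg p <= - m%:Z ->
       bcoord a p l j q = 0) ->
    exists q', q' \in @coord_ker a i /\ dgd Q e q' = q.
  elim: m => [|m IHm] {}q kq dq qm.
    exists 0; rewrite rpred0 dgd0; split=> //.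
    have [s [_ [_ ->]]] := expandedP R q; rewrite /expansion big1 // => p _.
    by rewrite qm ?grf0 ?grcomp0r ?bdeg_le0 // degK.
  have [|q1 [kq1 q1N]] := coord_ker_exact_step (N := - m%:Z) e kq dq.
    by move=> p l el pm; apply: qm => //; lia.
  have [||q2 [kq2 dq2]] := IHm (q - dgd Q e q1) _ _ q1N.
  - by rewrite rpredB // coord_ker_d.
  - by rewrite dgdB dq dgdd subr0.
  exists (q1 + q2); split; first by rewrite rpredD.
  by rewrite dgdD dq2 addrC subrK.
move=> kq dq; apply: (main (absz j).+1 q kq dq) => p l el pm.
by apply: bcoord_pos; lia.
Qed.

End Contraction.

(** * Comparison of homology modules *)

Section Isomorphisms.
Variable k : pzRingType.
Implicit Types U V W : lmodType k.

Lemma isomorphic_bij U V (f : {linear U -> V}) :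
  (forall u, f u = 0 -> u = 0) -> (forall v, exists u, f u = v) -> isomorphic U V.
Proof.
move=> f0 fs; exists f; have [g gK] := choice fs.
exists g => // u; apply/eqP; rewrite -subr_eq0; apply/eqP/f0.
by rewrite linearB gK subrr.
Qed.

Lemma isomorphic_sym U V : isomorphic U V -> isomorphic V U.
Proof.
move=> [f [g fK gK]].
have g_linear : linear g by move=> c u v; apply: (can_inj fK); rewrite linearP !gK.
pose g' : {linear V -> U} := HB.pack g (GRing.isLinear.Build _ _ _ _ _ g_linear).
by exists g'; exists f.
Qed.

Lemma isomorphic_trans V U W : isomorphic U V -> isomorphic V W -> isomorphic U W.
Proof.
move=> [f fb] [g gb]; exists (g \o f); exact: bij_comp.
Qed.

Lemma homology_iso_ker U V W (f : {linear U -> V}) (g : {linear V -> W}) (T : lmodType k)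
    (phi : {linear kermod g -> T}) :
  (forall z, phi z = 0 <-> exists u, f u = \val z) ->
  (forall t, exists z, phi z = t) -> isomorphic (homology f g) T.
Proof.
move=> phi0 phis.
pose h (q : homology f g) : T :=
  phi (repr (q : Quotient.quot (quotmod_pred (@boundary _ _ _ _ f g)))).
have hE z : h (quotmod_pi (@boundary _ _ _ _ f g) z) = phi z.
  apply/eqP; rewrite -subr_eq0 -linearB; apply/eqP/phi0.
  apply/asboolP; rewrite -[`[< _ >]]/(_ \in @boundary _ _ _ _ f g).
  by apply/quotmod_piE; rewrite quotmod_piK.
have h_linear : linear h.
  move=> c q q'; rewrite -[q](quotmod_piK (S := @boundary _ _ _ _ f g)) -[q']quotmod_piK.
  by rewrite -linearP !hE linearP.
pose h' : {linear homology f g -> T} := HB.pack h (GRing.isLinear.Build _ _ _ _ _ h_linear).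
apply: (@isomorphic_bij _ _ h') => [q|t].
  rewrite /= -[q](quotmod_piK (S := @boundary _ _ _ _ f g)) hE => /phi0 im.
  rewrite -[RHS](linear0 (quotmod_pi (@boundary _ _ _ _ f g))).
  by apply/quotmod_piE; rewrite subr0; apply/asboolP.
by have [z <-] := phis t; exists (quotmod_pi (@boundary _ _ _ _ f g) z); rewrite /= hE.
Qed.

Lemma homology_iso U V W U' V' W' (f : {linear U -> V}) (g : {linear V -> W})
    (f' : {linear U' -> V'}) (g' : {linear V' -> W'}) (phi : {linear V -> V'}) :
  (forall z, g z = 0 -> g' (phi z) = 0) ->
  (forall z, g z = 0 -> (exists u', f' u' = phi z) <-> exists u, f u = z) ->
  (forall z', g' z' = 0 -> exists z, g z = 0 /\ exists u', f' u' = phi z - z') ->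
  isomorphic (homology f g) (homology f' g').
Proof.
move=> phig phif phis.
have zP (z : kermod g) : phi (\val z) \in kerpred g'.
  by rewrite inE; apply/eqP/phig/eqP; exact: (ker_valP z).
pose psi z : homology f' g' := quotmod_pi (@boundary _ _ _ _ f' g') (KerMod (zP z)).
have psi_linear : linear psi.
  move=> c z z'; rewrite /psi -linearP; congr quotmod_pi.
  by apply: val_inj; rewrite /= linearP.
pose psi' : {linear kermod g -> homology f' g'} :=
  HB.pack psi (GRing.isLinear.Build _ _ _ _ _ psi_linear).
apply: (@homology_iso_ker _ _ _ f g _ psi') => [z|t].
  have gz : g (\val z) = 0 by apply/eqP; exact: (ker_valP z).
  rewrite -(phif _ gz) /= /psi -[X in _ = X](linear0 (quotmod_pi (@boundary _ _ _ _ f' g'))).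
  split=> [/quotmod_piE|im]; last apply/quotmod_piE; rewrite subr0.
    by move=> /asboolP.
  exact/asboolP.
rewrite -[t](quotmod_piK (S := @boundary _ _ _ _ f' g')); set z' := repr _.
have gz' : g' (\val z') = 0 by apply/eqP; exact: (ker_valP z').
have [z [gz im]] := phis _ gz'.
have zk : z \in kerpred g by rewrite inE gz.
exists (KerMod zk); rewrite /= /psi; apply/quotmod_piE; exact/asboolP.
Qed.

End Isomorphisms.

(** * Projective resolutions and the tensor product *)

Section ModuleHoms.
Variables (k : comPzRingType) (C : klincat k).

Section RModule.
Variable M : rmodule C.

Lemma ractB x y (f : C x y) (m m' : M y) : ract M f (m - m') = ract M f m - ract M f m'.
Proof. by apply/eqP; rewrite eq_sym subr_eq -ract_add subrK. Qed.
Lemma ract0 x y (f : C x y) : ract M f 0 = 0.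
Proof. by rewrite -[X in ract M f X](subrr 0) ractB subrr. Qed.
Lemma ract_sum (I : Type) (s : seq I) x y (f : C x y) (m : I -> M y) :
  ract M f (\sum_(i <- s) m i) = \sum_(i <- s) ract M f (m i).
Proof.
elim: s => [|i s IHs]; first by rewrite !big_nil ract0.
by rewrite !big_cons ract_add IHs.
Qed.
Lemma ract0l x y (m : M y) : ract M (0 : C x y) m = 0.
Proof. by apply: (addrI (ract M 0 m)); rewrite -(ract_addl m) !addr0. Qed.

End RModule.

Definition rmodhom_id (M : rmodule C) : rmodhom M M :=
  @RModHom k C M M (fun x => idfun) (fun _ _ _ _ => erefl).

Lemma rmodhom_comp_nat (M N P : rmodule C) (g : rmodhom N P) (f : rmodhom M N)
    x y (h : C x y) (m : M y) :
  (g x \o f x) (ract M h m) = ract P h ((g y \o f y) m).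
Proof. by rewrite /= !rmodhom_nat. Qed.
Definition rmodhom_comp (M N P : rmodule C) (g : rmodhom N P) (f : rmodhom M N) :
  rmodhom M P := @RModHom k C M P (fun x => g x \o f x) (rmodhom_comp_nat g f).

Lemma rmodhom_sub_nat (M N : rmodule C) (g f : rmodhom M N)
    x y (h : C x y) (m : M y) :
  (g x \- f x) (ract M h m) = ract N h ((g y \- f y) m).
Proof. by rewrite /= !rmodhom_nat ractB. Qed.
Definition rmodhom_sub (M N : rmodule C) (g f : rmodhom M N) :
  rmodhom M N := @RModHom k C M N (fun x => g x \- f x) (rmodhom_sub_nat g f).

Lemma rmodhom0_nat (M N : rmodule C) x y (h : C x y) (m : M y) :
  (\0 : M x -> N x) (ract M h m) = ract N h ((\0 : M y -> N y) m).
Proof. by rewrite /= ract0. Qed.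
Definition rmodhom0 (M N : rmodule C) : rmodhom M N :=
  @RModHom k C M N (fun x => \0) (@rmodhom0_nat M N).

(** The image of a homomorphism.  It turns a lifting problem against [f] into one
against an epimorphism, which is all that projectivity speaks about. *)
Section Image.
Variables (M N : rmodule C) (f : rmodhom M N).

Definition image_pred x : {pred N x} := fun n => `[< exists m, f x m = n >].
Fact image_zmod x : zmod_closed (@image_pred x).
Proof.
split=> [|n n' /asboolP[m <-] /asboolP[m' <-]]; apply/asboolP.
  by exists 0; rewrite raddf0.
by exists (m - m'); rewrite raddfB.
Qed.
HB.instance Definition _ x := GRing.isZmodClosed.Build (N x) (@image_pred x) (@image_zmod x).

Record image_ob x : Type :=
  ImageOb { image_val : N x; image_valP : image_val \in @image_pred x }.
HB.instance Definition _ x := [isSub for @image_val x].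
HB.instance Definition _ x := [Choice of image_ob x by <:].
HB.instance Definition _ x := [SubChoice_isSubZmodule of image_ob x by <:].

Fact image_ract_subproof x y (h : C x y) (n : image_ob y) :
  ract N h (image_val n) \in @image_pred x.
Proof.
have /asboolP[m mE] := image_valP n.
by apply/asboolP; exists (ract M h m); rewrite rmodhom_nat mE.
Qed.
Definition image_ract x y (h : C x y) (n : image_ob y) : image_ob x :=
  ImageOb (image_ract_subproof h n).

Definition image_rmod : rmodule C.
Proof.
apply: (@RModule k C image_ob image_ract).
- by move=> x y h m m'; apply: val_inj; exact: ract_add.
- by move=> x y m h h'; apply: val_inj; exact: ract_addl.
- by move=> x m; apply: val_inj; exact: ract_id.
- by move=> x y z g h m; apply: val_inj; exact: ract_comp.
Defined.

End Image.

Lemma projective_lift (P M N : rmodule C) (d : rmodhom M N) (f : rmodhom P N) :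
  rmod_projective P -> (forall x p, exists m, d x m = f x p) ->
  exists l : rmodhom P M, forall x p, d x (l x p) = f x p.
Proof.
move=> Pproj fd.
have corestr (K : rmodule C) (u : rmodhom K N) : (forall x p, exists m, d x m = u x p) ->
    exists v : rmodhom K (image_rmod d), forall x p, image_val (v x p) = u x p.
  move=> ud.
  have uP x p : u x p \in @image_pred _ _ d x by apply/asboolP.
  pose v x p : image_rmod d x := ImageOb (uP x p).
  have v_add x : zmod_morphism (v x).
    by move=> p p'; apply: val_inj; rewrite /= raddfB.
  pose V x : {additive K x -> image_rmod d x} :=
    HB.pack (v x) (GRing.isZmodMorphism.Build _ _ _ (v_add x)).
  have Vnat x y (h : C x y) (m : K y) : V x (ract K h m) = ract (image_rmod d) h (V y m).
    by apply: val_inj; rewrite /= rmodhom_nat.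
  by exists (RModHom Vnat).
have [g gE] := corestr M d (fun x p => ex_intro _ p erefl).
have [h hE] := corestr P f fd.
have [|l lE] := Pproj _ _ g h.
  move=> x n; have /asboolP[m mE] := image_valP n.
  by exists m; apply: val_inj; rewrite /= gE.
by exists l => x p; rewrite -gE lE hE.
Qed.

End ModuleHoms.

(** A resolution with [M] put in front, in index 0.  Chain maps and homotopies can
then be built by a recursion starting from the identity or zero of [M]. *)
Section AugmentedResolution.
Variables (k : comPzRingType) (C : klincat k) (M : rmodule C) (P : projres M).

Definition aug_ob n : rmodule C := if n is m.+1 then pr_ob P m else M.
Definition aug_d n : rmodhom (aug_ob n.+1) (aug_ob n) :=
  match n with 0 => pr_aug P | m.+1 => pr_d P m end.

Lemma aug_proj n : rmod_projective (aug_ob n.+1). Proof. exact: pr_proj. Qed.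
Lemma aug_exact n x (p : aug_ob n.+1 x) :
  aug_d n x p = 0 <-> exists q, aug_d n.+1 x q = p.
Proof. by case: n p => [|n] p; [exact: pr_exact0 | exact: pr_exact]. Qed.
Lemma aug_dd n x (p : aug_ob n.+2 x) : aug_d n x (aug_d n.+1 x p) = 0.
Proof. by apply/aug_exact; exists p. Qed.

End AugmentedResolution.
Arguments aug_ob {k C M} P n : simpl never.
Arguments aug_d {k C M} P n : simpl never.

Section Comparison.
Variables (k : comPzRingType) (C : klincat k) (M : rmodule C).

(** At each stage the last map is kept with the fact that its composite with the
differential lands in the image of the next differential, which is what the next
lift requires. *)
Lemma comparison_map (P P' : projres M) :
  exists phi : forall n, rmodhom (aug_ob P n) (aug_ob P' n),
    (forall x m, phi 0 x m = m) /\
    (forall n x p, aug_d P' n x (phi n.+1 x p) = phi n x (aug_d P n x p)).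
Proof.
pose ok n (f : rmodhom (aug_ob P n) (aug_ob P' n)) :=
  forall x p, exists q, aug_d P' n x q = f x (aug_d P n x p).
have step n (f : {f | ok n f}) : {g : {g | ok n.+1 g} |
    forall x p, aug_d P' n x (sval g x p) = sval f x (aug_d P n x p)}.
  apply: cid; case: f => f fok.
  have [|g gE] := projective_lift (f := rmodhom_comp f (aug_d P n)) (d := aug_d P' n)
    (@aug_proj _ _ _ P n) _; first exact: fok.
  have gok : ok n.+1 g.
    by move=> x p; apply/aug_exact; rewrite gE /= aug_dd raddf0.
  by exists (exist _ g gok).
have ok0 : ok 0 (rmodhom_id M) by move=> x p; exact: pr_aug_epi.
pose phi := nat_rect (fun n => {f | ok n f}) (exist _ _ ok0) (fun n f => sval (step n f)).
exists (fun n => sval (phi n)); split=> // n x p.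
exact: (svalP (step n (phi n))).
Qed.

(** The recursion of [comparison_map], applied to the difference between [psi] and
the part of the homotopy already built. *)
Lemma comparison_homotopy (P P' : projres M)
    (psi : forall n, rmodhom (aug_ob P n) (aug_ob P' n)) :
  (forall x m, psi 0 x m = 0) ->
  (forall n x p, aug_d P' n x (psi n.+1 x p) = psi n x (aug_d P n x p)) ->
  exists s : forall n, rmodhom (aug_ob P n) (aug_ob P' n.+1),
    forall n x p, psi n.+1 x p = aug_d P' n.+1 x (s n.+1 x p) + s n x (aug_d P n x p).
Proof.
move=> psi0 psid.
pose ok n (f : rmodhom (aug_ob P n) (aug_ob P' n.+1)) :=
  forall x p, exists q, aug_d P' n.+1 x q = psi n.+1 x p - f x (aug_d P n x p).
have step n (f : {f | ok n f}) : {g : {g | ok n.+1 g} |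
    forall x p, aug_d P' n.+1 x (sval g x p) = psi n.+1 x p - sval f x (aug_d P n x p)}.
  apply: cid; case: f => f fok.
  have [|g gE] := projective_lift
    (f := rmodhom_sub (psi n.+1) (rmodhom_comp f (aug_d P n))) (d := aug_d P' n.+1)
    (@aug_proj _ _ _ P n) _; first exact: fok.
  have gok : ok n.+1 g.
    move=> x p; apply/aug_exact; rewrite raddfB gE /= psid aug_dd raddf0 subr0.
    by rewrite subrr.
  by exists (exist _ g gok).
have ok0 : ok 0 (rmodhom0 _ _).
  by move=> x p; apply/aug_exact; rewrite raddfB psid psi0 /= raddf0 subr0.
pose s := nat_rect (fun n => {f | ok n f}) (exist _ _ ok0) (fun n f => sval (step n f)).
exists (fun n => sval (s n)) => n x p.
by have := svalP (step n (s n)) x p; rewrite /= => ->; rewrite subrK.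
Qed.

End Comparison.

Section TensorFunctoriality.
Variables (k : comPzRingType) (C : klincat k) (N : lmodule C).

Lemma tensor_map_tens (M M' : rmodule C) (f : rmodhom M M') x (m : M x) (n : N x) :
  tensor_map (N := N) f (tens m n) = tens (f x m) n.
Proof.
apply: tensor_lift_tens => *.
- by rewrite raddfD tensDl.
- by rewrite tensDr.
- by rewrite rmodhom_nat tens_bal.
Qed.

Lemma tens0l (M : rmodule C) x (n : N x) : tens (0 : M x) n = 0.
Proof. by apply: (addrI (tens 0 n)); rewrite -tensDl !addr0. Qed.
Lemma tens0r (M : rmodule C) x (m : M x) : tens m (0 : N x) = 0.
Proof. by apply: (addrI (tens m 0)); rewrite -tensDr !addr0. Qed.
Lemma tensBl (M : rmodule C) x (m m' : M x) (n : N x) :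
  tens (m - m') n = tens m n - tens m' n.
Proof. by apply/eqP; rewrite eq_sym subr_eq -tensDl subrK. Qed.

Lemma tensBr (M : rmodule C) x (m : M x) (n n' : N x) :
  tens m (n - n') = tens m n - tens m n'.
Proof. by apply/eqP; rewrite eq_sym subr_eq -tensDr subrK. Qed.

Lemma tensor_map_comp (M M' M'' : rmodule C) (g : rmodhom M' M'') (f : rmodhom M M') t :
  tensor_map (N := N) g (tensor_map (N := N) f t) = tensor_map (N := N) (rmodhom_comp g f) t.
Proof.
apply: (tensor_ext (f := tensor_map (N := N) g \o tensor_map (N := N) f)) => x m n /=.
by rewrite !tensor_map_tens.
Qed.

Lemma tensor_map_eq (M M' : rmodule C) (g f : rmodhom M M') t :
  (forall x m, g x m = f x m) -> tensor_map (N := N) g t = tensor_map (N := N) f t.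
Proof.
move=> gf; apply: (tensor_ext (f := tensor_map (N := N) g)) => x m n /=.
by rewrite !tensor_map_tens gf.
Qed.

Lemma tensor_map_id (M : rmodule C) (f : rmodhom M M) t :
  (forall x m, f x m = m) -> tensor_map (N := N) f t = t.
Proof.
move=> fE; apply: (tensor_ext (f := tensor_map (N := N) f) (g := idfun)) => x m n /=.
by rewrite !tensor_map_tens fE.
Qed.

Lemma tensor_map0 (M M' : rmodule C) (f : rmodhom M M') t :
  (forall x m, f x m = 0) -> tensor_map (N := N) f t = 0.
Proof.
move=> fE; apply: (tensor_ext (f := tensor_map (N := N) f) (g := \0)) => x m n /=.
by rewrite !tensor_map_tens fE tens0l.
Qed.

Lemma tensor_map_sum (M M' : rmodule C) (f g h : rmodhom M M') t :
  (forall x m, f x m = g x m + h x m) ->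
  tensor_map (N := N) f t = tensor_map (N := N) g t + tensor_map (N := N) h t.
Proof.
move=> fE; apply: (tensor_ext (f := tensor_map (N := N) f)
  (g := tensor_map (N := N) g \+ tensor_map (N := N) h)) => x m n /=.
by rewrite !tensor_map_tens fE tensDl.
Qed.

Lemma tensor_map_epi (M M' : rmodule C) (f : rmodhom M M') :
  rmod_epi f -> forall t, exists u, tensor_map (N := N) f u = t.
Proof.
move=> fs; apply: tensor_ind => [|x m n|t t' [u <-] [u' <-]].
- by exists 0; rewrite linear0.
- by have [m' <-] := fs x m; exists (tens m' n); rewrite tensor_map_tens.
- by exists (u - u'); rewrite linearB.
Qed.

(** Lifting along the epimorphism [f] defines a map from the tensor product over M''
to the cokernel of the map induced by [d]; its composite with the map induced by [f]
is the projection onto that cokernel. *)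
Lemma tensor_map_right_exact (M M' M'' : rmodule C) (d : rmodhom M M') (f : rmodhom M' M'') :
  rmod_epi f -> (forall x m, f x m = 0 -> exists m', d x m' = m) ->
  forall t, tensor_map (N := N) f t = 0 -> exists u, tensor_map (N := N) d u = t.
Proof.
move=> fs fd.
pose im : {pred tensor M' N} := fun t => `[< exists u, tensor_map (N := N) d u = t >].
have imS : submod_closed im.
  split=> [|c t t' /asboolP[u <-] /asboolP[u' <-]]; apply/asboolP.
    by exists 0; rewrite linear0.
  by exists (c *: u + u'); rewrite linearP.
pose Im : submodClosed (tensor M' N) := HB.pack im (GRing.isSubmodClosed.Build _ _ _ imS).
pose pi := quotmod_pi Im.
pose lift x (m : M'' x) := sval (cid (fs x m)).
have liftE x m : f x (lift x m) = m by exact: (svalP (cid (fs x m))).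
have pi_eq x (m m' : M' x) (n : N x) : f x m = f x m' -> pi (tens m n) = pi (tens m' n).
  move=> mm'; apply/quotmod_piE; rewrite -tensBl.
  have [|q <-] := fd x (m - m'); first by rewrite raddfB mm' subrr.
  by apply/asboolP; exists (tens q n); rewrite tensor_map_tens.
pose b x (m : M'' x) (n : N x) : quotmod Im := pi (tens (lift x m) n).
have bE x (m : M' x) n : b x (f x m) n = pi (tens m n) by apply: pi_eq; rewrite liftE.
have bDl x (m m' : M'' x) n : b x (m + m') n = b x m n + b x m' n.
  by rewrite -[in LHS](liftE x m) -[in LHS](liftE x m') -raddfD bE tensDl; exact: quotmod_piD.
have bDr x (m : M'' x) n n' : b x m (n + n') = b x m n + b x m n'.
  by rewrite /b tensDr; exact: quotmod_piD.
have bbal x y (h : C x y) (m : M'' y) (n : N x) : b x (ract M'' h m) n = b y m (lact N h n).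
  by rewrite -{1}(liftE y m) -rmodhom_nat bE tens_bal.
pose L0 t : quotmod Im := tensor_lift b t.
have L0_add : zmod_morphism L0 by exact: tensor_lift_add bDl bDr bbal.
pose L : {additive tensor M'' N -> quotmod Im} :=
  HB.pack L0 (GRing.isZmodMorphism.Build _ _ _ L0_add).
have LE t : L (tensor_map (N := N) f t) = pi t.
  apply: (tensor_ext (f := L \o tensor_map (N := N) f) (g := quotmod_pi Im)) => x m n /=.
  by rewrite tensor_map_tens /L0 tensor_lift_tens.
move=> t ft; suff /asboolP : t \in im by [].
have : pi t = pi 0 by rewrite -LE ft raddf0 /pi linear0.
by move=> /quotmod_piE; rewrite subr0.
Qed.

End TensorFunctoriality.
Section TorIndependence.
Variables (k : comPzRingType) (C : klincat k) (M : rmodule C) (N : lmodule C).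

Local Notation T f := (tensor_map (N := N) f).

Definition augmented_map (P P' : projres M)
    (phi : forall n, rmodhom (aug_ob P n) (aug_ob P' n)) : Prop :=
  (forall x m, phi 0 x m = m) /\
  (forall n x p, aug_d P' n x (phi n.+1 x p) = phi n x (aug_d P n x p)).

Lemma augmented_map_tensor (P P' : projres M) phi n t :
  @augmented_map P P' phi -> T (aug_d P' n) (T (phi n.+1) t) = T (phi n) (T (aug_d P n) t).
Proof.
by move=> [_ phid]; rewrite !tensor_map_comp; apply: tensor_map_eq => x p; rewrite /= phid.
Qed.

(** Augmented maps in opposite directions compose to a map homotopic to the identity,
so on cycles the composite differs from the identity by a boundary. *)
Lemma augmented_maps_inverse (P P' : projres M) phi chi n t :
  @augmented_map P P' phi -> @augmented_map P' P chi -> T (aug_d P n.+1) t = 0 ->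
  exists u, T (aug_d P n.+2) u = T (chi n.+2) (T (phi n.+2) t) - t.
Proof.
move=> [phi0 phid] [chi0 chid] dt.
pose psi n := rmodhom_sub (rmodhom_comp (chi n) (phi n)) (rmodhom_id _).
have [||s sE] := @comparison_homotopy _ _ _ P P psi.
- by move=> x m; rewrite /= phi0 chi0 subrr.
- by move=> m x p; rewrite /= raddfB chid phid.
exists (T (s n.+2) t).
have -> : T (chi n.+2) (T (phi n.+2) t) - t = T (psi n.+2) t.
  apply/eqP; rewrite subr_eq; apply/eqP.
  rewrite -[X in _ + X](tensor_map_id (f := rmodhom_id _) t) // tensor_map_comp.
  by apply: tensor_map_sum => x m; rewrite /= subrK.
rewrite (tensor_map_sum (g := rmodhom_comp (aug_d P n.+2) (s n.+2))
  (h := rmodhom_comp (s n.+1) (aug_d P n.+1))) => [|x m]; last exact: sE.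
by rewrite -!tensor_map_comp dt linear0 addr0.
Qed.

Lemma Tor_unique (P P' : projres M) n : isomorphic (Tor n.+1 P N) (Tor n.+1 P' N).
Proof.
have [phi phiP] := comparison_map P P'; have [chi chiP] := comparison_map P' P.
apply: (@homology_iso _ _ _ _ _ _ _ (T (aug_d P n.+2)) (T (aug_d P n.+1))
  (T (aug_d P' n.+2)) (T (aug_d P' n.+1)) (T (phi n.+2))) => /= [z dz|z dz|z dz].
- by rewrite (augmented_map_tensor _ phiP) dz linear0.
- have [w wE] := augmented_maps_inverse phiP chiP dz.
  split=> [[u uE]|[u <-]]; last first.
    by exists (T (phi n.+3) u); rewrite (augmented_map_tensor _ phiP).
  exists (T (chi n.+3) u - w).
  by rewrite linearB /= wE (augmented_map_tensor _ chiP) uE opprB addrC subrK.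
- exists (T (chi n.+2) z); split.
    by rewrite (augmented_map_tensor _ chiP) dz linear0.
  exact: augmented_maps_inverse chiP phiP dz.
Qed.

End TorIndependence.

(** A module with a dual basis: elements [m i] and natural coordinates [kappa] such
that every element is the finite combination of the [m i] with its coordinates.
This is one half of freeness, and it suffices for projectivity and for computing
tensor products. *)
Section DualBasis.
Variables (k : comPzRingType) (C : klincat k) (M : rmodule C).
Variables (I : choiceType) (o : I -> C) (m : forall i, M (o i)).
Variable kappa : forall x i, {additive M x -> C x (o i)}.
Hypothesis kappa_nat : forall x y (f : C x y) i (p : M y),
  kappa x i (ract M f p) = klcomp (kappa y i p) f.
Hypothesis dual : forall x (p : M x), exists s,
  [/\ uniq s, forall i, i \notin s -> kappa x i p = 0 &
      p = \sum_(i <- s) ract M (kappa x i p) (m i)].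

Lemma dual_basis_projective : rmod_projective M.
Proof.
move=> N L g h gs.
have lift i : exists n, g (o i) n = h (o i) (m i) by exact: gs.
pose n i := sval (cid (lift i)).
have nE i : g (o i) (n i) = h (o i) (m i) by exact: (svalP (cid (lift i))).
pose supp x p := sval (cid (@dual x p)).
have suppP x p := svalP (cid (@dual x p)).
pose l x (p : M x) : N x := \sum_(i <- supp x p) ract N (kappa x i p) (n i).
have lE x p s : uniq s -> (forall i, i \notin s -> kappa x i p = 0) ->
    l x p = \sum_(i <- s) ract N (kappa x i p) (n i).
  move=> us s0; have [up p0 _] := suppP x p.
  by apply: big_supp => // i si; [rewrite p0 | rewrite s0]; rewrite ?ract0l.
have l_add x : zmod_morphism (l x).
  move=> p q; pose s := undup (supp x p ++ supp x q).
  have us : uniq s by exact: undup_uniq.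
  have [_ p0 _] := suppP x p; have [_ q0 _] := suppP x q.
  have sp i : i \notin s -> kappa x i p = 0.
    by rewrite mem_undup mem_cat negb_or => /andP[/p0].
  have sq i : i \notin s -> kappa x i q = 0.
    by rewrite mem_undup mem_cat negb_or => /andP[_ /q0].
  rewrite !(lE x _ s) // => [|i si]; last by rewrite raddfB sp // sq // subrr.
  rewrite -sumrB; apply: eq_bigr => i _; rewrite raddfB.
  by apply/eqP; rewrite eq_sym subr_eq -(ract_addl (n i)) subrK.
pose L' x : {additive M x -> N x} :=
  HB.pack (l x) (GRing.isZmodMorphism.Build _ _ _ (l_add x)).
have L_nat x y (f : C x y) (p : M y) : L' x (ract M f p) = ract N f (L' y p).
  rewrite /=; have [up p0 _] := suppP y p.
  rewrite (lE x _ (supp y p)) // => [|i si]; last by rewrite kappa_nat p0 // klcomp0l.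
  by rewrite /l ract_sum; apply: eq_bigr => i _; rewrite kappa_nat ract_comp.
exists (RModHom L_nat) => x p /=.
have [_ _ {2}->] := suppP x p.
by rewrite /l !raddf_sum; apply: eq_bigr => i _; rewrite !rmodhom_nat nE.
Qed.

Variable N : lmodule C.
Variable lam : forall i, {additive tensor M N -> N (o i)}.
Hypothesis lamE : forall i x (p : M x) (n : N x),
  lam i (tens p n) = lact N (kappa x i p) n.

(** An element m.f (x) n is m (x) f.n, so that the expansion of the left factors
leaves one term per basis element.  Hence a tensor is determined by the values of
the maps [lam]. *)
Lemma dual_basis_tensor (t : tensor M N) : exists s,
  t = \sum_(i <- s) tens (m i) (lam i t).
Proof.
pose ok t s := [/\ uniq s, forall i, i \notin s -> lam i t = 0 &
  t = \sum_(i <- s) tens (m i) (lam i t)].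
suff [s [_ _ tE]] : exists s, ok t s by exists s.
have lact0l x y (n : N x) : lact N (0 : C x y) n = 0.
  by apply: (addrI (lact N 0 n)); rewrite -(lact_addl n) !addr0.
move: t; apply: tensor_ind => [|x p n|t u [s [us s0 tE]] [s' [us' s0' uE]]].
- by exists [::]; split=> // [i _|]; rewrite ?raddf0 // big_nil.
- have [s [us s0 pE]] := dual p; exists s; split=> // [i si|].
    by rewrite lamE s0 // lact0l.
  have tens_sum (J : Type) (r : seq J) (F : J -> M x) :
      tens (\sum_(j <- r) F j) n = \sum_(j <- r) tens (F j) n.
    by elim: r => [|j r IHr]; rewrite ?big_nil ?tens0l // !big_cons tensDl IHr.
  rewrite {1}pE tens_sum; apply: eq_bigr => i _.
  by rewrite tens_bal lamE.
pose r := undup (s ++ s').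
have ur : uniq r by exact: undup_uniq.
have rt i : i \notin r -> lam i t = 0.
  by rewrite mem_undup mem_cat negb_or => /andP[/s0].
have ru i : i \notin r -> lam i u = 0.
  by rewrite mem_undup mem_cat negb_or => /andP[_ /s0'].
exists r; split=> // [i ri|]; first by rewrite raddfB rt // ru // subrr.
have tE' : t = \sum_(i <- r) tens (m i) (lam i t).
  by rewrite {1}tE; apply: big_supp => // i ir; [rewrite s0 | rewrite rt]; rewrite ?tens0r.
have uE' : u = \sum_(i <- r) tens (m i) (lam i u).
  by rewrite {1}uE; apply: big_supp => // i ir; [rewrite s0' | rewrite ru]; rewrite ?tens0r.
rewrite {1}tE' {1}uE' -sumrB; apply: eq_bigr => i _.
by rewrite raddfB tensBr.
Qed.

End DualBasis.

(** * The reduced complex *)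

Section Reduction.
Variables (k : comPzRingType) (A : klincat k) (C : dgcat k A).
Variable pi : dgfunctor C (deg0 A).
Hypothesis pi_qis : quasi_isomorphism pi.
Hypothesis C_nonpos : forall a b, nonpositively_graded C a b.
Variables (Q : dgcat k A) (F : dgfunctor C Q) (X : A -> Prop) (b : A).
Variable R : right_basis F X b.

Local Notation coord_ker_at a i := (@coord_ker k A C pi Q F X b R a i).

(** The module Q(-, b) (x)_C A at [a]: the quotient of Q(a, b) by the submodule of
[coord_ker]. *)
Definition reduced a i : lmodType k := quotmod (coord_ker_at a i).
Definition reduce a i : {linear Q a b i -> reduced a i} :=
  quotmod_pi (coord_ker_at a i).

Lemma reduce_surj a i (y : reduced a i) : exists q, reduce a i q = y.
Proof.
exists (repr (y : Quotient.quot (quotmod_pred (coord_ker_at a i)))).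
exact: quotmod_piK.
Qed.

Lemma reduce_eq a i (q q' : Q a b i) :
  reduce a i q = reduce a i q' <-> q - q' \in coord_ker_at a i.
Proof. exact: quotmod_piE. Qed.

Lemma reduce_eq0 a i (q : Q a b i) :
  reduce a i q = 0 <-> q \in coord_ker_at a i.
Proof. by rewrite -(linear0 (reduce a i)) reduce_eq subr0. Qed.

Lemma reduced_lift a i (V : lmodType k) (f : {linear Q a b i -> V}) :
  (forall q, q \in coord_ker_at a i -> f q = 0) ->
  {g : {linear reduced a i -> V} | forall q, g (reduce a i q) = f q}.
Proof.
move=> fK; pose g y := f (sval (cid (reduce_surj y))).
have gE q : g (reduce a i q) = f q.
  rewrite /g; case: cid => q' /= /reduce_eq/fK/eqP.
  by rewrite linearB subr_eq0 => /eqP.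
have g_linear : linear g.
  move=> c y y'; have [q <-] := reduce_surj y; have [q' <-] := reduce_surj y'.
  by rewrite -linearP !gE linearP.
by exists (HB.pack g (GRing.isLinear.Build _ _ _ _ _ g_linear) : {linear reduced a i -> V}).
Qed.

Definition pilift a a' (f : A a a') : C a a' 0 := sval (cid (pi0_surj pi_qis f)).
Lemma piliftK a a' (f : A a a') : pi0 pi a a' (pilift f) = f.
Proof. exact: (svalP (cid (pi0_surj pi_qis f))). Qed.

Definition comp0 a a' i (c : C a a' 0) (q : Q a' b i) : Q a b i :=
  grcomp (addr0 i) q (F _ _ _ c).
Fact comp0_linear a a' i (c : C a a' 0) : linear (@comp0 a a' i c).
Proof. exact: grcomp_linl. Qed.
HB.instance Definition _ a a' i c :=
  GRing.isLinear.Build k (Q a' b i) (Q a b i) _ (@comp0 a a' i c) (@comp0_linear a a' i c).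

(** A morphism of A acts on the right through any of its lifts to C: two lifts differ
by an element of ker pi. *)
Lemma red_act_spec a a' i (f : A a a') :
  {g : {linear reduced a' i -> reduced a i} |
    forall q, g (reduce a' i q) = reduce a i (comp0 (pilift f) q)}.
Proof.
apply: (reduced_lift (f := reduce a i \o comp0 (pilift f))) => q kq /=.
by apply/reduce_eq0; exact: coord_ker_comp.
Qed.

Definition red_act a a' i (f : A a a') : {linear reduced a' i -> reduced a i} :=
  sval (red_act_spec i f).

Lemma red_actE a a' i (f : A a a') (c : C a a' 0) (q : Q a' b i) :
  pi0 pi a a' c = f -> red_act i f (reduce a' i q) = reduce a i (comp0 c q).
Proof.
move=> cf; rewrite (svalP (red_act_spec i f)); apply/reduce_eq.
rewrite -grcompBr -grfB; apply: coord_ker_compr.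
rewrite grfB; apply/eqP; rewrite subr_eq0; apply/eqP.
by rewrite -[LHS]/(pi0 _ _ _ _) piliftK.
Qed.

Lemma red_act_addl a a' i (f g : A a a') y :
  red_act i (f + g) y = red_act i f y + red_act i g y.
Proof.
have [q <-] := reduce_surj y.
rewrite (red_actE _ (piliftK f)) (red_actE _ (piliftK g)).
rewrite (red_actE (c := pilift f + pilift g)); last by rewrite linearD !piliftK.
by rewrite -linearD /comp0 grfD grcompDr.
Qed.

Lemma red_act_scale a a' i l (f : A a a') y : red_act i (l *: f) y = l *: red_act i f y.
Proof.
have [q <-] := reduce_surj y.
rewrite (red_actE _ (piliftK f)) (red_actE (c := l *: pilift f)); last first.
  by rewrite linearZ /= piliftK.
by rewrite -linearZ /comp0 grfZ grcompZr.
Qed.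

Lemma red_act_id a i y : red_act i (klid A a) y = y.
Proof.
have [q <-] := reduce_surj y; rewrite (red_actE (c := grid C a)); last exact: (grf_id pi).
by rewrite /comp0 grf_id grcomp1r.
Qed.

Lemma red_act_comp a a' a'' i (g : A a' a'') (f : A a a') y :
  red_act i (klcomp g f) y = red_act i f (red_act i g y).
Proof.
have [q <-] := reduce_surj y.
rewrite (red_actE _ (piliftK g)) (red_actE _ (piliftK f)).
rewrite (red_actE (c := grcomp (addr0 0) (pilift g) (pilift f))); last first.
  by rewrite pi0_comp !piliftK.
by congr (reduce a i _); rewrite /comp0 grf_comp; exact: grcompA.
Qed.

Definition red_rmod i : rmodule (fullsub X) :=
  @RModule k (fullsub X) (fun x => reduced (sval x) i)
    (fun x y f => red_act i (f : A (sval x) (sval y)))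
    (fun x y f => raddfD (red_act i (f : A (sval x) (sval y))))
    (fun x y m f g => red_act_addl f g m) (fun x m => red_act_id m)
    (fun x y z g f m => red_act_comp g f m).

Lemma red_d_spec a i j (e : i + 1 = j) :
  {g : {linear reduced a i -> reduced a j} |
    forall q, g (reduce a i q) = reduce a j (dgd Q e q)}.
Proof.
apply: (reduced_lift (f := reduce a j \o dgd Q e)) => q kq /=.
by apply/reduce_eq0; exact: coord_ker_d.
Qed.
Definition red_d a i j (e : i + 1 = j) : {linear reduced a i -> reduced a j} :=
  sval (red_d_spec a e).
Lemma red_dE a i j (e : i + 1 = j) q : red_d a e (reduce a i q) = reduce a j (dgd Q e q).
Proof. exact: (svalP (red_d_spec a e)). Qed.

Lemma dgd_comp0 a a' i j (e : i + 1 = j) (c : C a a' 0) (q : Q a' b i) :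
  dgd Q e (comp0 c q) = comp0 c (dgd Q e q).
Proof.
rewrite /comp0 (dgd_grcompF F _ e (add0r 1) _ (addr0 j) e).
by rewrite [dgd C _ c]C_nonpos // grf0 grcomp0r scaler0 addr0.
Qed.

Lemma red_d_act a a' i j (e : i + 1 = j) (f : A a a') y :
  red_d a e (red_act i f y) = red_act j f (red_d a' e y).
Proof.
have [q <-] := reduce_surj y.
by rewrite (red_actE _ (piliftK f)) !red_dE dgd_comp0 (red_actE _ (piliftK f)).
Qed.

Definition red_dmod i j (e : i + 1 = j) : rmodhom (red_rmod i) (red_rmod j) :=
  @RModHom k (fullsub X) (red_rmod i) (red_rmod j)
    (fun x => red_d (sval x) e) (fun x y f m => red_d_act e f m).

(** The projection onto the reduced complex is a quasi-isomorphism, as its kernel is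
acyclic. *)
Lemma homology_red a i j l (e : i + 1 = j) (e' : j + 1 = l) :
  isomorphic (homology (@dgd k A Q a b i j e) (@dgd k A Q a b j l e'))
    (homology (red_d a e) (red_d a e')).
Proof.
apply: (homology_iso (phi := reduce a j)) => [q dq|q dq|y].
- by rewrite red_dE dq linear0.
- split=> [[y]|[u <-]]; last by exists (reduce a i u); rewrite red_dE.
  have [u <-] := reduce_surj y; rewrite red_dE => /reduce_eq kuq.
  have duq : dgd Q e' (dgd Q e u - q) = 0 by rewrite dgdB dgdd dq subrr.
  have [u1 [_ u1E]] := coord_ker_exact pi_qis C_nonpos e kuq duq.
  by exists (u - u1); rewrite dgdB u1E opprB addrC subrK.
have [q <-] := reduce_surj y; rewrite red_dE => /reduce_eq0 kdq.
have [q1 [kq1 q1E]] := coord_ker_exact pi_qis C_nonpos e' kdq (dgdd e' (erefl (l + 1)) q).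
exists (q - q1); split; first by rewrite dgdB q1E subrr.
exists 0; rewrite linear0; apply/esym/eqP; rewrite subr_eq0; apply/eqP/reduce_eq.
by rewrite addrAC subrr add0r rpredN.
Qed.

Section Degree.
Variable i : int.
Hypothesis i_neq0 : i != 0.

(** In degree [i] the coordinates that survive in A are those at the basis words of
degree [i]; the others are set to 0. *)
Lemma kappa_spec a (t : rb_tail R) :
  {g : {linear reduced a i -> A a (rb_tsrc t)} |
    (rb_tdeg t = i -> forall q, g (reduce a i q) =
      pi0 pi a _ (bcoord (R := R) a (Some t) 0 i q)) /\
    (rb_tdeg t <> i -> forall y, g y = 0)}.
Proof.
have [ti|ti] := eqVneq (rb_tdeg t) i; last first.
  by exists \0; split=> // ti'; rewrite ti' eqxx in ti.
have [|g gE] := reduced_lift (f := pi0 pi a _ \o bcoord (R := R) a (Some t) 0 i).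
  by move=> q /asboolP kq; apply: (kq (Some t) 0); rewrite /bdeg /= ti addr0.
by exists g; split.
Qed.

Definition kappa a t : {linear reduced a i -> A a (rb_tsrc t)} := sval (kappa_spec a t).

Lemma kappaE a t q : rb_tdeg t = i ->
  kappa a t (reduce a i q) = pi0 pi a _ (bcoord (R := R) a (Some t) 0 i q).
Proof. by case: (svalP (kappa_spec a t)) => + _ => /[apply]. Qed.

Lemma kappa0 a t y : rb_tdeg t <> i -> kappa a t y = 0.
Proof. by case: (svalP (kappa_spec a t)) => _ + => /[apply]. Qed.

Lemma kappa_act a a' t (f : A a a') y : kappa a t (red_act i f y) = klcomp (kappa a' t y) f.
Proof.
have [ti|ti] := eqVneq (rb_tdeg t) i; last by rewrite !kappa0 ?klcomp0l //; exact/eqP.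
have [q <-] := reduce_surj y; rewrite (red_actE _ (piliftK f)) !kappaE //.
have e : bdeg (R := R) (Some t) + 0 = i by rewrite addr0.
by rewrite /comp0 (bcoord_comp (addr0 i) (addr0 0) e) pi0_comp piliftK.
Qed.

(** The class of the basis word [t] in degree [i], and 0 if [i] is not its degree. *)
Definition tail_elt (t : rb_tail R) : reduced (rb_tsrc t) i :=
  match rb_tdeg t =P i with
  | ReflectT e => reduce _ i (eq_rect _ (fun i => Q _ b i) (rb_tval t) i e)
  | ReflectF _ => 0
  end.

(** The expansion of a representative of [y], where the terms at basis words of degree
other than [i] have coefficients of nonzero degree, killed by pi.  The empty word is
among these since [i] is not 0. *)
Lemma tail_dual a (y : reduced a i) : exists s : seq (rb_tail R),
  [/\ uniq s, forall t, t \notin s -> kappa a t y = 0 &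
      y = \sum_(t <- s) red_act i (kappa a t y) (tail_elt t)].
Proof.
have [q <-] := reduce_surj y; have [s [q0 [us qE]]] := expandedP R q.
exists (pmap id s); split.
- by apply: (pmap_uniq (g := Some)) => // -[].
- move=> t; rewrite mem_pmap map_id => ts.
  have [ti|ti] := eqVneq (rb_tdeg t) i; last by rewrite kappa0 //; exact/eqP.
  by rewrite kappaE // q0 // linear0.
rewrite {1}qE /expansion linear_sum /= sum_pmap_id.
  apply: eq_bigr => t _.
  have [ti|ti] := eqVneq (rb_tdeg t) i; last first.
    rewrite kappa0 //; last exact/eqP.
    have -> : red_act i (0 : A a (rb_tsrc t)) (tail_elt t) = 0.
      by apply: (addrI (red_act i 0 (tail_elt t))); rewrite -red_act_addl !addr0.
    apply/reduce_eq0/coord_ker_compr/pi_ne0.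
    by rewrite subr_eq0 eq_sym.
  have transport a' d i' (el : Q a' b d) (e : d + 0 = i') (di : d = i') (c : C a a' 0) :
      grcomp e el (F _ _ _ c) = comp0 c (eq_rect d (fun i => Q a' b i) el i' di).
    by case: i' / di e => e; rewrite /comp0 (eq_irrelevance e (addr0 d)).
  have tailE : tail_elt t = reduce _ i (eq_rect _ (fun i => Q _ b i) (rb_tval t) i ti).
    rewrite /tail_elt; case: eqP => // e.
    by rewrite (eq_irrelevance e ti).
  rewrite tailE (kappaE _ ti) (red_actE _ erefl) -[LHS]/(reduce a i _).
  congr (reduce a i _).
  suff gen j (e : bdeg (R := R) (Some t) + j = i) : j = 0 ->
      grcomp e (bel (R := R) (Some t)) (F _ _ _ (bcoord a (Some t) j i q)) =
      comp0 (bcoord (R := R) a (Some t) 0 i q)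
        (eq_rect _ (fun i => Q _ b i) (rb_tval t) i ti).
    by apply: gen; rewrite /bdeg /= ti subrr.
  by move=> j0; subst j; exact: transport.
apply/reduce_eq0/coord_ker_compr/pi_ne0.
by rewrite /bdeg /= subr0.
Qed.

Definition tail_ob (t : rb_tail R) : fullsub X := exist _ (rb_tsrc t) (rb_tsrcX t).

Definition kappa_add (x : fullsub X) t : {additive red_rmod i x -> fullsub X x (tail_ob t)} :=
  kappa (sval x) t.

Lemma red_rmod_projective : rmod_projective (red_rmod i).
Proof.
apply: (dual_basis_projective (m := tail_elt : forall t, red_rmod i (tail_ob t))
  (kappa := kappa_add)) => [x y f t p|x p]; first exact: kappa_act.
exact: tail_dual.
Qed.

End Degree.

(** The action of A on the reduced module extends its restriction to X: at any [a] it
is the tensor product of that restriction with A(a, -). *)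
Section TensorComparison.
Variables (i : int) (a : A).

Definition mu : tensor (red_rmod i) (hom_from X a) -> reduced a i :=
  tensor_lift (fun (x : fullsub X) (y : red_rmod i x) (f : hom_from X a x) =>
    red_act i (f : A a (sval x)) (y : reduced (sval x) i)).

Fact mu_linear : linear mu.
Proof.
apply: tensor_lift_linear => [x y y' f|x y f g|x y f p g|c x y f] /=.
- exact: linearD.
- exact: red_act_addl.
- by rewrite red_act_comp.
- by rewrite klcompZl klcomp1l red_act_scale.
Qed.
HB.instance Definition _ := GRing.isLinear.Build k
  (tensor (red_rmod i) (hom_from X a)) (reduced a i) _ mu mu_linear.

Lemma mu_tens (x : fullsub X) (y : reduced (sval x) i) (f : A a (sval x)) :
  mu (tens (y : red_rmod i x) (f : hom_from X a x)) = red_act i f y.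
Proof.
apply: tensor_lift_tens => {x y f} [x y y' f|x y f g|x y f p g] /=.
- exact: linearD.
- exact: red_act_addl.
- by rewrite red_act_comp.
Qed.

Hypothesis i_neq0 : i != 0.

Lemma mu_inj t : mu t = 0 -> t = 0.
Proof.
move=> t0.
pose lam u : {additive tensor (red_rmod i) (hom_from X a) -> hom_from X a (tail_ob u)} :=
  kappa i a u \o mu.
have [|s ->] := dual_basis_tensor (o := tail_ob)
  (m := tail_elt i : forall t, red_rmod i (tail_ob t)) (kappa := kappa_add i)
  (fun x => @tail_dual i i_neq0 (sval x)) (N := hom_from X a) (lam := lam) _ t.
  by move=> u x p n; rewrite /= mu_tens kappa_act.
by rewrite big1 // => u _; rewrite /= t0 linear0 tens0r.
Qed.

Lemma mu_surj y : exists t, mu t = y.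
Proof.
have [s [_ _ ->]] := tail_dual i_neq0 y.
exists (\sum_(u <- s) tens (tail_elt i u : red_rmod i (tail_ob u))
  (kappa i a u y : hom_from X a (tail_ob u))).
by rewrite linear_sum; apply: eq_bigr => u _; exact: mu_tens.
Qed.

End TensorComparison.

Lemma mu_d i j (e : i + 1 = j) a t :
  @mu j a (tensor_map (red_dmod e) t) = red_d a e (@mu i a t).
Proof.
apply: (tensor_ext (f := @mu j a \o tensor_map (red_dmod e))
  (g := red_d a e \o @mu i a)) => x y f /=.
by rewrite tensor_map_tens !mu_tens red_d_act.
Qed.

Lemma homology_mu i j l (e : i + 1 = j) (e' : j + 1 = l) a (W : lmodType k)
    (g : {linear tensor (red_rmod j) (hom_from X a) -> W}) :
  i != 0 -> j != 0 -> (forall t, g t = 0 <-> red_d a e' (@mu j a t) = 0) ->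
  isomorphic (homology (tensor_map (N := hom_from X a) (red_dmod e)) g)
    (homology (red_d a e) (red_d a e')).
Proof.
move=> i0 j0 gE; apply: (homology_iso (phi := @mu j a)) => [t|t _|y dy].
- by move=> /gE.
- split=> [[y ye]|[u <-]]; last by exists (@mu i a u); rewrite /= mu_d.
  have [u uy] := mu_surj i0 y; exists u.
  apply/eqP; rewrite -subr_eq0; apply/eqP/(mu_inj j0).
  by rewrite linearB /= mu_d uy ye subrr.
have [t ty] := mu_surj j0 y; exists t; rewrite gE /= ty; split=> //.
by exists 0; rewrite linear0 subrr.
Qed.

Lemma Negz_succ n : Negz n.+1 + 1 = Negz n. Proof. by lia. Qed.
Lemma Negz_succ0 : Negz 0 + 1 = 0. Proof. by []. Qed.

(** The reduced module in degree 0 is A(-, b), through the coordinate at the empty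
word. *)
Definition unit_coord a : {linear Q a b 0 -> A a b} :=
  pi0 pi a b \o bcoord (R := R) a None 0 0.

Lemma unit_coord_ker a q : unit_coord a q = 0 <-> q \in coord_ker_at a 0.
Proof.
split=> [q0|/asboolP kq]; last exact: (kq None 0).
apply/asboolP=> -[t|] j e; last first.
  have ej : j = 0 by rewrite -e /bdeg add0r.
  by subst j.
rewrite bcoord_pos ?grf0 //; move: e (rb_tdeg_lt0 t); rewrite /bdeg /=.
by lia.
Qed.

Lemma unit_coordF a c : unit_coord a (F a b 0 c) = pi0 pi a b c.
Proof.
rewrite /unit_coord /=; congr (pi0 pi a b _).
rewrite -[F _ _ _ c](grcomp1l (add0r 0)).
exact: (bcoord_same (R := R) (p := None)).
Qed.

Lemma unit_coord_comp0 a a' (c : C a a' 0) q :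
  unit_coord a (comp0 c q) = klcomp (unit_coord a' q) (pi0 pi a a' c).
Proof.
rewrite /unit_coord /comp0 /=.
by rewrite (bcoord_comp (R := R) (p := None) (addr0 0) (addr0 0) (addr0 0)) pi0_comp.
Qed.

(** The last differential of the reduced complex, with values in A(a, b). *)
Lemma aug_spec a : {g : {linear reduced a (Negz 0) -> A a b} |
  forall q, g (reduce a (Negz 0) q) = unit_coord a (dgd Q Negz_succ0 q)}.
Proof.
apply: (reduced_lift (f := unit_coord a \o dgd Q Negz_succ0)) => q kq /=.
by apply/unit_coord_ker; exact: coord_ker_d.
Qed.
Definition aug a : {linear reduced a (Negz 0) -> A a b} := sval (aug_spec a).
Lemma augE a q : aug a (reduce a (Negz 0) q) = unit_coord a (dgd Q Negz_succ0 q).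
Proof. exact: (svalP (aug_spec a)). Qed.

Lemma aug_eq0 a y : aug a y = 0 <-> red_d a Negz_succ0 y = 0.
Proof.
have [q <-] := reduce_surj y.
by rewrite augE red_dE reduce_eq0 unit_coord_ker.
Qed.

Lemma aug_act a a' (f : A a a') y : aug a (red_act (Negz 0) f y) = klcomp (aug a' y) f.
Proof.
have [q <-] := reduce_surj y.
by rewrite (red_actE _ (piliftK f)) !augE dgd_comp0 unit_coord_comp0 piliftK.
Qed.

Definition aug_mod : rmodhom (red_rmod (Negz 0)) (hom_to X b) :=
  @RModHom k (fullsub X) (red_rmod (Negz 0)) (hom_to X b)
    (fun x => aug (sval x)) (fun x y f m => aug_act (f : A (sval x) (sval y)) m).

(** Under [mu] the last differential of the reduced complex is the composite of the
augmentation with the canonical map. *)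
Lemma can_aug a t : can X a b (tensor_map (N := hom_from X a) aug_mod t) = aug a (mu t).
Proof.
apply: (tensor_ext (f := can X a b \o tensor_map aug_mod) (g := aug a \o @mu _ a)) => x y f /=.
by rewrite tensor_map_tens can_tens mu_tens aug_act.
Qed.

(** * Cohomology of the quotient *)

Variable eps : forall x : {x : A | X x}, Q (sval x) (sval x) (-1).
Hypothesis d_eps : forall x, dgd Q (addNr 1) (eps x) = grid Q (sval x).

(** By the Leibniz rule and d(eps_x) = 1, composing a cocycle with eps_x gives a
primitive of it, up to sign. *)
Lemma contract_eps (x : {x : A | X x}) i j l (e : i + 1 = j) (e' : j + 1 = l)
    (q : Q (sval x) b j) :
  dgd Q e' q = 0 -> exists u, dgd Q e u = q.
Proof.
move=> dq; have ei : j - 1 = i by rewrite -e addrK.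
have ej : l - 1 = j by rewrite -e' addrK.
exists ((-1) ^+ absz j *: grcomp ei q (eps x)).
rewrite dgdZ (dg_leibniz ei e' (addNr 1) e ej (addr0 j)) dq grcomp0l add0r d_eps.
by rewrite grcomp1r signrZK.
Qed.

(** At objects of X the complex Q(-, b) is contractible, hence the quasi-isomorphic
reduced complex is exact; the proof corrects a representative of a cycle into a
cocycle. *)
Lemma red_exact (x : {x : A | X x}) i j l (e : i + 1 = j) (e' : j + 1 = l) y :
  red_d (sval x) e' y = 0 <-> exists z, red_d (sval x) e z = y.
Proof.
split=> [|[z <-]]; last first.
  by have [q <-] := reduce_surj z; rewrite !red_dE dgdd linear0.
have [q <-] := reduce_surj y; rewrite red_dE => /reduce_eq0 kdq.
have [q1 [kq1 q1E]] := coord_ker_exact pi_qis C_nonpos e' kdq (dgdd e' (erefl (l + 1)) q).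
have dz : dgd Q e' (q - q1) = 0 by rewrite dgdB q1E subrr.
have [u uE] := contract_eps e dz.
exists (reduce _ i u); rewrite red_dE uE; apply/reduce_eq.
by rewrite addrAC subrr add0r rpredN.
Qed.

(** A preimage of g is the class of c eps_x, where c is a lift of g to C. *)
Lemma aug_epi : rmod_epi aug_mod.
Proof.
move=> x g; have [c cg] := pi0_surj pi_qis (g : A (sval x) b).
exists (reduce _ (Negz 0) (grcomp (add0r (-1)) (F _ _ _ c) (eps x))).
rewrite /= augE -[RHS]cg -unit_coordF; congr (unit_coord _ _).
rewrite (dg_leibniz _ (add0r 1) (addNr 1) _ (subrr 1) (addr0 0)) -dgf_d.
by rewrite [dgd C _ c]C_nonpos // grf0 grcomp0l add0r d_eps grcomp1r expr0 scale1r.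
Qed.

Lemma aug_exact0 x (p : red_rmod (Negz 0) x) :
  aug_mod x p = 0 <-> exists q, red_dmod (Negz_succ 0) x q = p.
Proof. by rewrite [aug_mod x p = 0]aug_eq0; exact: red_exact. Qed.

(** The part of negative degree of the reduced complex, restricted to X. *)
Definition red_projres : projres (hom_to X b) :=
  @ProjRes k (fullsub X) (hom_to X b) (fun n => red_rmod (Negz n))
    (fun n => red_dmod (Negz_succ n)) aug_mod
    (fun n => @red_rmod_projective (Negz n) isT) aug_epi aug_exact0
    (fun n x p => @red_exact x _ _ _ (Negz_succ n.+1) (Negz_succ n) p).

Lemma dgcohomologyE a i j l (e : i + 1 = j) (e' : j + 1 = l) :
  dgcohomology Q a b j = homology (@dgd k A Q a b i j e) (@dgd k A Q a b j l e').
Proof.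
have ei : i = j - 1 by rewrite -e addrK.
subst i l; rewrite /dgcohomology; congr homology; congr dgd; exact: eq_irrelevance.
Qed.

(** In degrees <= -2 the reduced complex only involves the terms of [red_projres]. *)
Lemma cohomology_Tor n a :
  isomorphic (dgcohomology Q a b (Negz n.+1)) (Tor n.+1 red_projres (hom_from X a)).
Proof.
rewrite (dgcohomologyE a (Negz_succ n.+1) (Negz_succ n)).
apply: (isomorphic_trans (homology_red _ _ _)); apply: isomorphic_sym.
apply: (@homology_mu _ _ _ (Negz_succ n.+1) (Negz_succ n) a _
  (tensor_map (N := hom_from X a) (red_dmod (Negz_succ n)))) => // t.
by rewrite -mu_d /=; split=> [->|/mu_inj->//]; rewrite ?linear0.
Qed.

(** The cycles of degree -1 of the reduced complex are the tensors killed by the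
canonical map after augmentation; by right exactness the augmentation identifies
them, modulo boundaries, with the kernel of the canonical map. *)
Lemma cohomology_ker_can a :
  isomorphic (dgcohomology Q a b (Negz 0)) (kermod (can X a b)).
Proof.
rewrite (dgcohomologyE a (Negz_succ 0) Negz_succ0).
apply: (isomorphic_trans (homology_red _ _ _)).
apply: (@isomorphic_trans _ (homology (tensor_map (N := hom_from X a) (red_dmod (Negz_succ 0)))
  (can X a b \o tensor_map (N := hom_from X a) aug_mod))).
  by apply/isomorphic_sym/homology_mu => // t; rewrite /= can_aug aug_eq0.
set g := (_ \o _).
pose phi (z : kermod g) : kermod (can X a b) :=
  KerMod (ker_valP z : tensor_map aug_mod (\val z) \in kerpred (can X a b)).
have phi_linear : linear phi.
  by move=> c z z'; apply: val_inj; rewrite /= linearP.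
apply: (@homology_iso_ker _ _ _ _ _ _ _
  (HB.pack phi (GRing.isLinear.Build _ _ _ _ _ phi_linear))) => [z|t] /=.
  split=> [pz|[u uE]].
    have {}pz : tensor_map aug_mod (\val z) = 0 := congr1 val pz.
    apply: (tensor_map_right_exact aug_epi _ pz) => x m am.
    exact/aug_exact0.
  apply: val_inj; rewrite /= -uE tensor_map_comp; apply: tensor_map0 => x m /=.
  by apply/aug_exact0; exists m.
have [u uE] := tensor_map_epi (N := hom_from X a) aug_epi (\val t).
have uk : u \in kerpred g by rewrite inE /= uE; exact: (ker_valP t).
by exists (KerMod uk); apply: val_inj.
Qed.

(** The boundaries of degree 0 are, modulo ker pi, the values of the canonical map,
that is, the morphisms factoring through an object of X. *)
Lemma cohomology_factor (addX : additive_cat (fullsub X)) a :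
  isomorphic (dgcohomology Q a b 0) (factor_hom addX a b).
Proof.
rewrite (dgcohomologyE a Negz_succ0 (add0r 1)).
have d0 q : dgd Q (add0r 1) q = 0 :> Q a b 1 by apply: (Q_nonpos C_nonpos R).
pose piX : {linear A a b -> factor_hom addX a b} := quotmod_pi _.
have piX0 v : piX v = 0 <-> v \in @factor_ideal k A X a b.
  rewrite -(linear0 piX) -[v in v \in _]subr0; exact: quotmod_piE.
have [I0 IB] := GRing.submod_closedB (factor_ideal_submod addX a b).
have can_ideal t : can X a b t \in @factor_ideal k A X a b.
  move: t; apply: tensor_ind => [|x g f|t u It Iu]; first by rewrite linear0.
    by rewrite can_tens; apply/asboolP; exists x, g, f.
  by rewrite linearB; exact: IB.
apply: (@homology_iso_ker _ _ _ _ _ _ _ (piX \o unit_coord a \o val)) => [z|t].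
  rewrite -[_ z]/(piX (unit_coord a (val z))) piX0.
  split=> [/asboolP[x [g [h zE]]]|[u uE]]; last first.
    rewrite -uE -augE; have [t <-] := mu_surj (i := Negz 0) isT (reduce a _ u).
    by rewrite -can_aug.
  have [t tE] := tensor_map_epi (N := hom_from X a) aug_epi
    (tens (g : hom_to X b x) (h : hom_from X a x)).
  have [u uE] := reduce_surj (mu t).
  have : val z - dgd Q Negz_succ0 u \in coord_ker_at a 0.
    apply/unit_coord_ker; rewrite linearB zE -augE uE -can_aug tE can_tens.
    by rewrite subrr.
  move=> /(coord_ker_exact pi_qis C_nonpos Negz_succ0)/(_ (d0 _))[q [_ qE]].
  by exists (q + u); rewrite dgdD qE subrK.
have [v <-] : exists v, piX v = t.
  exists (repr (t : Quotient.quot (quotmod_pred _))); exact: quotmod_piK.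
have [c <-] := pi0_surj pi_qis v.
have Fk : F a b 0 c \in kerpred (@dgd k A Q a b _ _ (add0r 1)) by rewrite inE d0.
exists (KerMod Fk); exact: (congr1 (fun v => piX v) (@unit_coordF a c)).
Qed.

End Reduction.

Theorem proposition5p1 (k : comPzRingType) (A : klincat k) (addA : additive_cat A)
    (X : A -> Prop) (addX : additive_cat (fullsub X))
    (At : semifree_resolution A) (Q : dg_quotient At X) (a b : A) :
  nonpositively_graded Q a b /\
  isomorphic (dgcohomology Q a b 0) (factor_hom addX a b) /\
  isomorphic (dgcohomology Q a b (-1)) (kermod (can X a b)) /\
  (forall (P : projres (hom_to X b)) (n : nat), (2 <= n)%N ->
     isomorphic (dgcohomology Q a b (- n%:Z)) (Tor n.-1 P (hom_from X a))).
Proof.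
have [G [x x_free]] := semi_free_free_on (sfr_semi_free At).
have y_free := free_on_nonpos (@sfr_nonpos _ _ At) x_free.
have deg_le0 (g : nonpos_fam G) : gdeg g <= 0 by exact: svalP g.
pose R := right_basis_of deg_le0 y_free (@dgq_free _ _ _ _ Q) b.
have qis := @sfr_qis _ _ At; have nonpos := @sfr_nonpos _ _ At.
have d_eps := @dgq_d_eps _ _ _ _ Q.
split; first exact: (Q_nonpos nonpos R).
split; first exact: (cohomology_factor qis nonpos R d_eps).
split; first exact: (cohomology_ker_can qis nonpos R d_eps).
move=> P [|[|n]] // _.
apply: (isomorphic_trans (cohomology_Tor qis nonpos R d_eps n a)).
exact: Tor_unique.
Qed.
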